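(* Let $d>6$ be an integer, let $L_0=L_0(d)$ be the constant described in the context, and let $L\geq L_0$ be an integer. There exist constants $c,C>0$ such that, for spread-out Bernoulli percolation on $\mathbb{Z}^d$ with spread parameter $L$ and critical point $p_c=p_c(d,L)$, for every integer $n\geq 1$, $$\frac{c}{n^3}\leq \mathbb{P}_{p_c}\big[0\stackrel{\mathbb{H}}{\longleftrightarrow}\Lambda_n^c\big]\leq\frac{C}{n^3}.$$
   Context: Spread-out Bernoulli percolation on $\mathbb{Z}^d$ with spread parameter $L\geq 1$: consider the graph with vertex set $\mathbb{Z}^d$ and edge set $E_L=\{\{x,y\}\subset\mathbb{Z}^d: x\neq y,\ |x-y|\leq L\}$, where $|x|=\max_{1\leq i\leq d}|x_i|$; write $x\sim y$ if $\{x,y\}\in E_L$. For $p\in[0,1]$, $\mathbb{P}_p$ is the law of the random subgraph obtained by keeping (declaring open) each edge of $E_L$ independently with probability $p$ and removing it with probability $1-p$. For $A,B,S\subset\mathbb{Z}^d$, $\{A\stackrel{S}{\longleftrightarrow}B\}$ is the event that there is a path of open edges from a vertex of $A$ to a vertex of $B$ all of whose vertices lie in $S$; $S=\mathbb{Z}^d$ is omitted from the notation, and singletons $\{x\}$ are written $x$. $\tau_p^S(x,y)=\mathbb{P}_p[x\stackrel{S}{\longleftrightarrow}y]$, $\tau_p=\tau_p^{\mathbb{Z}^d}$. The critical point is $p_c=p_c(d,L)=\inf\{p\in[0,1]:\mathbb{P}_p[0\leftrightarrow\infty]>0\}$, where $\{0\leftrightarrow\infty\}$ is the event that the cluster of $0$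 is infinite. $\Lambda_n=[-n,n]^d\cap\mathbb{Z}^d$, $\Lambda_n^c=\mathbb{Z}^d\setminus\Lambda_n$; $\mathbb{H}=\{0,1,2,\ldots\}\times\mathbb{Z}^{d-1}$, and $\mathbb{H}_n=\mathbb{H}-n\mathbf{e}_1$ for $n\in\mathbb{Z}$, with $\mathbf{e}_1=(1,0,\ldots,0)$. For $S\subset\mathbb{Z}^d$ containing $0$, $\varphi_p(S)=p\sum_{x\in S,\,y\notin S,\,x\sim y}\tau_p^S(0,x)$. For $p<p_c$, $\chi(p)=\sum_{x\in\mathbb{Z}^d}\tau_p(0,x)$ and $L(p)=\min\{k\geq 1:\varphi_p(\Lambda_k)\leq 1/e^2\}$. The constant $L_0=L_0(d)\geq 1$: it is the constant provided by a known theorem of Duminil-Copin and Panis, namely it is such that for every $L\geq L_0$ there exist $c_1,C_1>0$ such that $c_1(p_c-p)^{-1}\leq\chi(p)\leq C_1(p_c-p)^{-1}$ and $c_1(p_c-p)^{-1/2}\leq L(p)\leq C_1(p_c-p)^{-1/2}$ for every $p<p_c$, and $\varphi_p(\mathbb{H}_n)\leq C_1\exp(-c_1(p_c-p)^{1/2}n)$ for every $p\leq p_c$ and $n\geq 0$. *)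

(* Defs.v *)
From HB Require Import structures.
From mathcomp Require Import all_boot all_order all_algebra.
From mathcomp Require Import all_classical all_reals all_analysis.
From mathcomp Require Import measurable_realfun.
From mathcomp Require Import zify.

Set Implicit Arguments.
Unset Strict Implicit.
Unset Printing Implicit Defensive.

Import Order.TTheory GRing.Theory Num.Theory.
Import numFieldNormedType.Exports.

Local Open Scope classical_set_scope.
Local Open Scope ring_scope.

Section bernoulli_product.
Context {R : realType} {I : choiceType}.

Definition open_sets : set (set (I -> bool)) :=
  [set [set w : I -> bool | w i] | i in [set: I]].

Definition config := g_sigma_algebraType open_sets.

Definition is_bernoulli_product (p : R) (P : probability config R) :=
  forall (s : seq I) (b : I -> bool), uniq s ->
    P [set w : config | forall i, i \in s -> w i = b i] =
    (\prod_(i <- s) (if b i then p else 1 - p))%:E.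

(* The law of a family of i.i.d. Bernoulli(p) variables indexed by I, selected
   by its finite-dimensional marginals (which determine it, since they form a
   pi-system).  It exists for I countable and 0 <= p <= 1: see
   [bernoulli_productP]. *)
Definition bernoulli_product (p : R) : probability config R :=
  get (is_bernoulli_product p).

End bernoulli_product.
Arguments config : clear implicits.
Arguments bernoulli_product {R} I p.

(* Existence: if U is uniform on [0, 1[ and [next] is the map sending both
   [0, p[ and [p, 1[ affinely onto [0, 1[, the events "the n-th iterate of U
   is less than p" are independent of probability p. *)
Section bernoulli_existence.
Context {R : realType} (p : R) (p01 : 0 <= p <= 1).

Let next (t : R) : R := if t < p then t / p else (t - p) / (1 - p).
Let bit (u : R) (n : nat) : bool := iter n next u < p.

Let wt (o : option bool) : R :=
  if o is Some c then (if c then p else 1 - p) else 1.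

Let ev (l : seq (option bool)) : set R :=
  [set u | `[0, 1[%classic u /\
           forall k c, nth None l k = Some c -> bit u k = c].

Let next01 t : 0 <= t < 1 -> 0 <= next t < 1.
Proof.
move=> /andP[t0 t1]; have /andP[p0 p1] := p01; rewrite /next.
case: ltP => tp.
  have pp : 0 < p by exact: le_lt_trans tp.
  by rewrite divr_ge0//= ltr_pdivrMr// mul1r.
have pp : 0 < 1 - p by rewrite subr_gt0; exact: le_lt_trans t1.
by rewrite divr_ge0 ?subr_ge0//= ltr_pdivrMr// mul1r ltrD2r.
Qed.

Let ev_cons (o : bool) l u : 0 <= u < 1 ->
  ev (Some o :: l) u <-> (u < p) = o /\ ev l (next u).
Proof.
move=> u01; split => [[_ H]|[H0 [_ H]]].
  split; first exact: (H 0%N o).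
  split; first by rewrite /= in_itv/= next01.
  by move=> k c kc; have := H k.+1 c kc; rewrite /bit iterSr.
split; first by rewrite /= in_itv/=.
move=> [|k] c /=; first by case=> <-.
by move=> kc; rewrite /bit iterSr; exact: (H k).
Qed.

Let ev_itv (l : seq bool) : exists a c : R,
  [/\ 0 <= a, a <= c, c <= 1, c - a = \prod_(x <- map Some l) wt x &
      ev (map Some l) = `[a, c[%classic].
Proof.
have /andP[p0 p1] := p01.
elim: l => [|o l [a [c [a0 ac c1 cal H]]]].
  exists 0, 1; split => //; first by rewrite big_nil subr0.
  apply/seteqP; split => [u []//|u u01]; split => //.
  by move=> k d; rewrite nth_nil.
have HE v : 0 <= v < 1 -> ev (map Some l) v <-> a <= v < c.
  by move=> _; rewrite H /= in_itv/=.
rewrite /= big_cons; case: o => /=.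
- exists (p * a), (p * c); rewrite -mulrBr cal; split => //.
  + by rewrite mulr_ge0.
  + by rewrite ler_wpM2l.
  + by rewrite mulr_ile1// (le_trans a0).
  apply/seteqP; split=> u.
    move=> evu; have u01 : 0 <= u < 1 by case: evu; rewrite /= in_itv.
    move: evu => /(ev_cons _ _ u01)[up] /HE -/(_ (next01 u01)).
    rewrite /next up /= in_itv/=.
    have pp : 0 < p by apply: le_lt_trans up; case/andP: u01.
    by rewrite ler_pdivlMr// ltr_pdivrMr// ![p * _]mulrC.
  rewrite /= in_itv/= => /andP[au uc].
  have u0 : 0 <= u by rewrite (le_trans _ au)// mulr_ge0.
  have up : u < p by rewrite (lt_le_trans uc)// ler_piMr.
  have pp : 0 < p by exact: le_lt_trans up.
  have u01 : 0 <= u < 1 by rewrite u0 (lt_le_trans up).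
  apply/ev_cons => //; split => //; apply/HE; first exact: next01.
  by rewrite /next up ler_pdivlMr// ltr_pdivrMr// ![_ * p]mulrC au.
- exists (p + (1 - p) * a), (p + (1 - p) * c); split => //.
  + by rewrite addr_ge0// mulr_ge0// subr_ge0.
  + by rewrite lerD2l ler_wpM2l// subr_ge0.
  + rewrite -lerBrDl ler_piMr// subr_ge0//.
  + by rewrite opprD addrACA subrr add0r -mulrBr cal.
  apply/seteqP; split=> u.
    move=> evu; have u01 : 0 <= u < 1 by case: evu; rewrite /= in_itv.
    move: evu => /(ev_cons _ _ u01)[up] /HE -/(_ (next01 u01)).
    have pu : p <= u by rewrite leNgt up.
    rewrite /next up /= in_itv/=.
    have pp : 0 < 1 - p.
      by rewrite subr_gt0; apply: le_lt_trans pu _; case/andP: u01.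
    rewrite ler_pdivlMr// ltr_pdivrMr// ![(1 - p) * _]mulrC.
    by rewrite lerBrDl ltrBlDl.
  rewrite /= in_itv/= => /andP[au uc].
  have pu : p <= u by rewrite (le_trans _ au)// lerDl mulr_ge0// subr_ge0.
  have u1 : u < 1.
    by rewrite (lt_le_trans uc)// -lerBrDl ler_piMr// subr_ge0.
  have up : (u < p) = false by apply/negbTE; rewrite -leNgt.
  have pp : 0 < 1 - p by rewrite subr_gt0; exact: le_lt_trans u1.
  have u01 : 0 <= u < 1 by rewrite u1 (le_trans p0).
  apply/ev_cons => //; split => //; apply/HE; first exact: next01.
  rewrite /next up ler_pdivlMr// ltr_pdivrMr// ![_ * (1 - p)]mulrC.
  by rewrite lerBrDl ltrBlDl au.
Qed.

Let mu := @lebesgue_measure R.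

Let measurable_iter n : measurable_fun [set: R] (iter n next).
Proof.
elim: n => [|n ih]; first exact: measurable_id.
have mnext : measurable_fun [set: R] next.
  apply: measurable_fun_ifT.
  - exact: measurable_fun_ltr.
  - exact: measurable_funM.
  - by apply: measurable_funM => //; exact: measurable_funB.
rewrite (_ : iter n.+1 next = next \o iter n next); last exact/funext.
exact: measurableT_comp.
Qed.

Let measurable_bit n : measurable [set u | bit u n].
Proof.
rewrite (_ : [set u | _] = iter n next @^-1` `]-oo, p[).
  by rewrite -[X in measurable X]setTI; exact: measurable_iter.
by apply/seteqP; split => u; rewrite /= in_itv.
Qed.

Let measurable_ev l : measurable (ev l).
Proof.
rewrite (_ : ev l = `[0, 1[%classic `&`
    \bigcap_k (if nth None l k is Some c then
      (if c then [set u | bit u k] else ~` [set u | bit u k]) else setT)).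
  apply: measurableI => //; apply: bigcapT_measurable => k.
  by case: nth => [[]|] //; exact: measurableC.
apply/seteqP; split => u [u01 H]; split => //.
  move=> k _ /=; have := H k; case: nth => [c /(_ c erefl)|//].
  by case: c => //= ->.
move=> k c kc; have := H k I; rewrite kc.
by case: c kc => //= _ /negP/negbTE.
Qed.

Let mu_itv (a c : R) : a <= c -> mu `[a, c[%classic = (c - a)%:E.
Proof.
move=> ac; rewrite /mu lebesgue_measure_itv/= lte_fin.
by case: ltgtP ac => // -> _; rewrite subrr.
Qed.

Let mu_ev (l1 : seq bool) (l2 : seq (option bool)) :
  mu (ev (map Some l1 ++ l2)) = (\prod_(x <- map Some l1 ++ l2) wt x)%:E.
Proof.
elim: l2 l1 => [|[c|] l2 ih] l1.
- rewrite cats0; have [a [c [a0 ac c1 cal ->]]] := ev_itv l1.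
  by rewrite mu_itv// cal.
- by have := ih (rcons l1 c); rewrite map_rcons cat_rcons.
have := ih (rcons l1 false); have := ih (rcons l1 true).
rewrite !map_rcons !cat_rcons => Ht Hf.
have split_ev : ev (map Some l1 ++ None :: l2) =
    ev (map Some l1 ++ Some true :: l2) `|`
    ev (map Some l1 ++ Some false :: l2).
  apply/seteqP; split => u.
    move=> [u01 H].
    have [ub|ub] := boolP (bit u (size l1)); [left|right]; split => // k c;
      have := H k c; rewrite !nth_cat size_map; case: ltnP => // lk;
      case E : (k - size l1)%N => [|m] //= _ [<-];
      have -> : k = size l1 by lia.
    - exact: ub.
    - exact: negbTE.
  by case=> -[u01 H]; split => // k c kc; apply: H; move: kc;
    rewrite !nth_cat; case: ifP => // _; case: (k - _)%N.
have mu_split : mu (ev (map Some l1 ++ None :: l2)) =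
    (mu (ev (map Some l1 ++ Some true :: l2)) +
     mu (ev (map Some l1 ++ Some false :: l2)))%E.
  rewrite split_ev; apply: measureU; [exact: measurable_ev..|].
  rewrite -subset0 => u [[_ Ht'] [_ Hf']].
  have := Ht' (size l1) true; have := Hf' (size l1) false.
  by rewrite !nth_cat size_map ltnn subnn /= => /(_ erefl) -> /(_ erefl).
rewrite mu_split Ht Hf -EFinD !big_cat !big_cons /=; congr EFin.
by rewrite mul1r -mulrDr -mulrDl addrC subrK mul1r.
Qed.

Context {I : choiceType} (f : I -> nat) (f_inj : injective f).

Let toconfig (u : R) : config I := fun i => bit u (f i).

Let measurable_toconfig : measurable_fun [set: R] toconfig.
Proof.
apply: (@measurability _ _ (measurableTypeR R) (config I) setT toconfig open_sets) => //.
move=> _ [_ [i _ <-] <-]; rewrite setTI; exact: measurable_bit.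
Qed.

Let law (A : set (config I)) : \bar R :=
  mu (`[0, 1[%classic `&` toconfig @^-1` A).

Let measurable_law A : measurable A ->
  measurable (`[0, 1[%classic `&` toconfig @^-1` A : set (measurableTypeR R)).
Proof.
move=> mA; apply: measurableI => //.
rewrite -[X in measurable X]setTI; exact: measurable_toconfig.
Qed.

Let law0 : law set0 = 0%E.
Proof. by rewrite /law preimage_set0 setI0; exact: measure0. Qed.

Let law_ge0 A : (0 <= law A)%E.
Proof. exact: measure_ge0. Qed.

Let law_sigma_additive : semi_sigma_additive law.
Proof.
move=> F mF tF mUF; rewrite /law preimage_bigcup setI_bigcupr.
apply: measure_semi_sigma_additive.
- by move=> n; exact: measurable_law.
- apply/trivIsetP => /= i j _ _ ij; rewrite -subset0 => u [[_ Fi] [_ Fj]].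
  have /trivIsetP/(_ i j Logic.I Logic.I ij) Fij := tF.
  by have : (F i `&` F j) (toconfig u) by []; rewrite Fij.
- by rewrite -setI_bigcupr -preimage_bigcup; exact: measurable_law.
Qed.

HB.instance Definition _ := isMeasure.Build _ _ _ law
  law0 law_ge0 law_sigma_additive.

Let lawT : law [set: _] = 1%:E.
Proof.
by rewrite /law preimage_setT setIT mu_itv// subr0.
Qed.

HB.instance Definition _ := Measure_isProbability.Build _ _ _ law lawT.

Lemma bernoulli_product_exists :
  exists P : probability (config I) R, is_bernoulli_product p P.
Proof.
exists law => s b us.
pose g k := ohead [seq b i | i <- s & f i == k].
have gf i : i \in s -> g (f i) = Some (b i).
  move=> si; rewrite /g (eq_filter (a2 := pred1 i)); last first.
    by move=> j /=; rewrite (inj_eq f_inj).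
  by rewrite filter_pred1_uniq.
have gE k c : g k = Some c -> exists2 i, i \in s & f i = k /\ b i = c.
  rewrite /g; case E : [seq i <- s | f i == k] => [//|i r] /= [<-].
  have : i \in [seq i <- s | f i == k] by rewrite E mem_head.
  by rewrite mem_filter => /andP[/eqP fik si]; exists i.
have [N fN] : exists N, forall i, i \in s -> (f i < N)%N.
  exists (\max_(i <- s) f i).+1 => i si.
  by rewrite ltnS; exact: leq_bigmax_seq.
rewrite [LHS](_ : _ = mu (ev (map Some [::] ++ mkseq g N))); last first.
  congr (mu _); apply/seteqP; split => u [u01 H]; split => //.
    move=> k c /=; have [kN|Nk] := ltnP k N.
      by rewrite nth_mkseq// => /gE[i si [<- <-]]; exact: H.
    by rewrite nth_default// size_mkseq.
  by move=> i si; apply: H => /=; rewrite nth_mkseq ?gf// fN.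
rewrite mu_ev /= /mkseq big_map; congr EFin.
rewrite (bigID (mem (map f s)))/= [X in _ * X]big1 ?mulr1; last first.
  move=> k /negP kfs; case E : (g k) => [c|//]; case: kfs.
  by have [i si [<- _]] := gE _ _ E; exact: map_f.
rewrite -big_filter (perm_big (map f s)); last first.
  apply: uniq_perm; rewrite ?filter_uniq ?iota_uniq ?map_inj_uniq//.
  move=> k; rewrite mem_filter mem_iota add0n leq0n andbC /=.
  apply: andb_idl => /mapP[i si ->]; exact: fN.
rewrite big_map big_seq [RHS]big_seq; apply: eq_bigr => i si.
by rewrite gf.
Qed.

End bernoulli_existence.

Lemma bernoulli_productP (R : realType) (I : choiceType) (p : R) :
  countable [set: I] -> 0 <= p <= 1 ->
  is_bernoulli_product p (bernoulli_product I p).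
Proof.
move=> /countable_injP[f f_inj] p01; rewrite /bernoulli_product.
apply: getPex; apply: (@bernoulli_product_exists _ _ p01 _ f).
by move=> i j; apply: f_inj; rewrite inE.
Qed.

Section percolation.
Context (d : nat).
Local Notation V := 'rV[int]_d.

Section graph.
Context (L : nat).

(* [`|x - y|] is the norm of matrices, i.e., the largest absolute value of an
   entry. *)
Definition edges : set (set V) :=
  [set e | exists x y, [/\ x <> y, `|x - y| <= L%:Z & e = [set x; y]]].

Definition adjacent (x y : V) : Prop := edges [set x; y].

Lemma countable_edges : countable [set: edges].
Proof.
have [f fP] : {f : edges -> V * V & forall e, val e = [set (f e).1; (f e).2]}.
  apply: (@choice _ _ (fun e xy => val e = [set xy.1; xy.2])) => e.
  by have [x [y [_ _ ->]]] := set_valP e; exists (x, y).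
apply/countable_injP; exists (choice.pickle \o f) => e e' _ _ /=.
move=> /(pcan_inj choice.pickleK) ff; apply: val_inj.
by rewrite !fP ff.
Qed.

Definition open_edge (w : config edges) (x y : V) : Prop :=
  exists2 e : edges, val e = [set x; y] & w e.

(* There is an open path, possibly reduced to a single vertex, from A to B with
   all its vertices in S. *)
Definition connected_in (w : config edges) (S A B : set V) : Prop :=
  exists (x : V) (s : seq V),
    [/\ A x, B (last x s), (forall z, z \in x :: s -> S z) &
        path (fun u v => `[< open_edge w u v >]) x s].

Definition cluster (w : config edges) (x : V) : set V :=
  [set y | connected_in w setT [set x] [set y]].

End graph.

Definition e1 : V := \row_i (i == 0 :> nat)%:R.

Definition box (n : nat) : set V :=
  [set x | forall i, - n%:Z <= x 0 i <= n%:Z].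

Definition half_space : set V :=
  [set x | forall i : 'I_d, i = 0 :> nat -> 0 <= x 0 i].

Definition shifted_half_space (n : int) : set V :=
  [set x - n *: e1 | x in half_space].

Context (R : realType) (L : nat).

Definition percolation (p : R) : probability (config (edges L)) R :=
  bernoulli_product (edges L) p.

Lemma percolationP (p : R) : 0 <= p <= 1 ->
  is_bernoulli_product p (percolation p).
Proof. by apply: bernoulli_productP; exact: countable_edges. Qed.

Definition connection_probability (p : R) (S A B : set V) : \bar R :=
  percolation p [set w | connected_in w S A B].

Definition tau (p : R) (S : set V) (x y : V) : \bar R :=
  connection_probability p S [set x] [set y].

Definition critical_point : R :=
  inf [set p | 0 <= p <= 1 /\
               (0 < percolation p [set w | infinite_set (cluster w 0)])%E].

Definition phi (p : R) (S : set V) : \bar R :=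
  (p%:E * \esum_(xy in [set xy | [/\ S xy.1, ~ S xy.2 & adjacent L xy.1 xy.2]])
            tau p S 0%R xy.1)%E.

Definition susceptibility (p : R) : \bar R :=
  \esum_(x in [set: V]) tau p setT 0 x.

(* The infimum is a minimum, unless no k >= 1 satisfies the condition, in which
   case it is +oo. *)
Definition correlation_length (p : R) : \bar R :=
  ereal_inf [set k%:R%:E | k in
    [set k : nat | (0 < k)%N /\ (phi p (box k) <= ((expR 1 ^+ 2)^-1)%:E)%E]].

(* The estimates of Duminil-Copin and Panis at spread parameter L. *)
Definition near_critical_estimates : Prop :=
  let pc := critical_point in
  exists c1 C1 : R, [/\ 0 < c1, 0 < C1,
    (forall p, 0 <= p < pc ->
       ((c1 * (pc - p)^-1)%:E <= susceptibility p <= (C1 * (pc - p)^-1)%:E)%E),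
    (forall p, 0 <= p < pc ->
       ((c1 * (Num.sqrt (pc - p))^-1)%:E <= correlation_length p
          <= (C1 * (Num.sqrt (pc - p))^-1)%:E)%E) &
    (forall (p : R) (n : nat), 0 <= p <= pc ->
       (phi p (shifted_half_space n%:Z)
          <= (C1 * expR (- c1 * Num.sqrt (pc - p) * n%:R))%:E)%E)].

End percolation.

Arguments near_critical_estimates d R L : clear implicits.
Arguments critical_point d R L : clear implicits.
Arguments connection_probability d {R} L p S A B.
Arguments half_space {d}.
Arguments box {d} n.

(* Main.v *)
(* For p < p_c put eps = p_c - p. Exploring the cluster of 0 in a domain D at
   parameter p instead of p_c costs a relative entropy of order eps^2 times the
   expected cluster size at p, so that for every arm event in D
     P_{p_c}[A] <= 2 P_p[A] + O(eps^2 E_p|C_D(0)|).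
   Take eps = (K / n)^2, so that the correlation length at p is a small multiple
   of n and P_p decays by any prescribed factor over the distance n.
   In the full space E_p|C(0)| is at most of order 1/eps, and a recursion over
   scales yields an arm probability of order at most n^-2. In the half-space
   E_p|C_H(0)| is of order eps^(-1/2) by the exponential decay of phi_p(H_k), so
   the entropic error is of order n^-3. Moreover the half-space arm is at most
   the expected number E X of exits of the box by the cluster of 0, times the
   full-space arm; the second moment of X is at most of order n by the tree-graph
   inequality, so that E X is at most n^2 P[X > 0] + O(1/n): the recursion closes.
   For the lower bound, choose p with correlation length above n, so that
   phi_p(box n) >= e^-2. Cutting a path from 0 to the top of the box at its lowest
   point gives E X >= c/n, whence P[X > 0] >= (E X)^2 / (4 E X^2) >= c/n^3. *)

Require Import Defs.
From mathcomp Require Import all_boot all_order all_algebra finmap.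
From mathcomp Require Import all_classical all_reals all_analysis.
From mathcomp Require Import perm zify ring lra.

Set Implicit Arguments.
Unset Strict Implicit.
Unset Printing Implicit Defensive.

Import Order.TTheory GRing.Theory Num.Theory.
Import numFieldNormedType.Exports.
Local Open Scope classical_set_scope.
Local Open Scope ring_scope.

(** * Finitely many Bernoulli variables and the BK inequality *)

(** The bounds on the susceptibility and on the correlation length hold only strictly below $p_c$,
    so the upper bounds at $p_c$ go through the entropic comparison. Its factor 2 bounds
    $1/(1-e^{-1})$ and comes from testing the relative entropy on $e^{-1_A}$. The order in which
    constants are fixed matters in the half-space recursion. The second-moment cutoff is [lam]
    $=m^2$, which the full-space bound $A m^{-2}$ cancels exactly, so contraction comes only from
    the factor $4^{-j}$, with $j$ chosen after $A$. A larger $j$ forces a larger $K$: this inflates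
    the constant of the additive error but not its power of $m$, and [power_law_of_recursion] asks
    for a small contraction factor, not for a small error. Arms and fluxes are events of finite
    boxes, so their probabilities become expectations [Ex] over a finite list of edges, and the
    probabilistic inequalities are proved by induction on that list; [bernoulli_product_determined]
    makes the link with the product measure. *)

Definition ind {R : realType} (Q : Prop) : R := `[< Q >]%:R.

Lemma ind_true (R : realType) (Q : Prop) : Q -> ind Q = 1 :> R.
Proof. by move=> q; rewrite /ind asboolT. Qed.

Lemma ind_false (R : realType) (Q : Prop) : ~ Q -> ind Q = 0 :> R.
Proof. by move=> q; rewrite /ind asboolF. Qed.

Lemma ind_ge0 (R : realType) (Q : Prop) : 0 <= ind Q :> R.
Proof. by rewrite /ind ler0n. Qed.

Lemma ind_le1 (R : realType) (Q : Prop) : ind Q <= 1 :> R.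
Proof. by rewrite /ind; case: asboolP => _ //; rewrite ler01. Qed.

Lemma ind_le (R : realType) (Q1 Q2 : Prop) : (Q1 -> Q2) -> ind Q1 <= ind Q2 :> R.
Proof.
move=> Q12; have [q1|nq1] := pselect Q1; last by rewrite ind_false// ind_ge0.
by rewrite !ind_true//; exact: Q12.
Qed.

Section bernoulli_expectation.
Context {R : realType} {I : choiceType}.
Implicit Types (w : I -> bool) (s : seq I) (F G : (I -> bool) -> R) (p q : R).

Definition upd w (e : I) (b : bool) : I -> bool :=
  fun i => if i == e then b else w i.

(* The expectation of [F] when the coordinates in [s] are independent
   Bernoulli(p) variables and the other ones are [false]. *)
Fixpoint Ex p s F : R :=
  if s is e :: s' then
    p * Ex p s' (fun w => F (upd w e true)) +
    (1 - p) * Ex p s' (fun w => F (upd w e false))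
  else F (fun=> false).

Lemma upd_id w e : upd w e (w e) = w.
Proof. by apply/funext => i; rewrite /upd; case: eqP => [->|]. Qed.

Lemma updC w e e' b b' : e != e' ->
  upd (upd w e b) e' b' = upd (upd w e' b') e b.
Proof.
move=> /eqP ee'; apply/funext => i; rewrite /upd.
by case: eqP => [->|//]; case: eqP => // e'e; case: ee'.
Qed.

Lemma upd_upd w e b b' : upd (upd w e b) e b' = upd w e b'.
Proof. by apply/funext => i; rewrite /upd; case: eqP. Qed.

Lemma le_Ex p s F G : 0 <= p <= 1 -> (forall w, F w <= G w) ->
  Ex p s F <= Ex p s G.
Proof.
move=> /andP[p0 p1]; elim: s F G => [|e s ih] F G FG /=; first exact: FG.
by rewrite lerD// ler_wpM2l ?subr_ge0//; apply: ih => w; exact: FG.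
Qed.

Lemma eq_Ex p s F G : (forall w, F w = G w) -> Ex p s F = Ex p s G.
Proof. by move=> /funext ->. Qed.

Lemma Ex_cst p s (c : R) : Ex p s (fun=> c) = c.
Proof. by elim: s => //= e s ->; rewrite -mulrDl addrC subrK mul1r. Qed.

Lemma ExD p s F G : Ex p s (fun w => F w + G w) = Ex p s F + Ex p s G.
Proof.
by elim: s F G => [//|e s ih] F G /=; rewrite !ih; ring.
Qed.

Lemma ExZ p s (c : R) F : Ex p s (fun w => c * F w) = c * Ex p s F.
Proof. by elim: s F => [//|e s ih] F /=; rewrite !ih; ring. Qed.

Lemma Ex_sum p s (J : Type) (l : seq J) (Q : pred J) (F : J -> (I -> bool) -> R) :
  Ex p s (fun w => \sum_(j <- l | Q j) F j w) = \sum_(j <- l | Q j) Ex p s (F j).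
Proof.
elim: l => [|j l ih].
  by rewrite big_nil -[RHS](Ex_cst p s 0); apply: eq_Ex => w; rewrite big_nil.
rewrite big_cons; have [Qj|nQj] := boolP (Q j).
  by rewrite -ih -ExD; apply: eq_Ex => w; rewrite big_cons Qj.
by rewrite -ih; apply: eq_Ex => w; rewrite big_cons (negbTE nQj).
Qed.

Lemma Ex_ge0 p s F : 0 <= p <= 1 -> (forall w, 0 <= F w) -> 0 <= Ex p s F.
Proof. by move=> p01 F0; rewrite -(Ex_cst p s 0); exact: le_Ex. Qed.

Definition increasing F := forall w w', (forall e, w e -> w' e) -> F w <= F w'.

Lemma increasing_upd F e b : increasing F -> increasing (fun w => F (upd w e b)).
Proof.
move=> Fi w w' ww'; apply: Fi => i; rewrite /upd.
by case: eqP => // _; exact: ww'.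
Qed.

(** Induction on the list replaces the monotone coupling: at each coordinate, passing from [p] to
    [q] moves weight to the larger of the two conditional expectations. *)
Lemma Ex_increasing p q s F : 0 <= p -> p <= q -> q <= 1 -> increasing F ->
  Ex p s F <= Ex q s F.
Proof.
move=> p0 pq q1; elim: s F => [//|e s ih] F Fi /=.
have H1 := ih _ (increasing_upd e true Fi).
have H0 := ih _ (increasing_upd e false Fi).
have H01 : Ex q s (fun w => F (upd w e false)) <= Ex q s (fun w => F (upd w e true)).
  apply: le_Ex; first by rewrite q1 (le_trans p0).
  by move=> w; apply: Fi => i; rewrite /upd; case: eqP.
by nra.
Qed.

Lemma Ex_map p s (h : I -> I) F : injective h ->
  Ex p (map h s) (fun w => F (w \o h)) = Ex p s F.
Proof.
move=> hi; elim: s F => [//|e s ih] F /=.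
have E b : Ex p (map h s) (fun w => F (upd w (h e) b \o h)) =
           Ex p s (fun w => F (upd w e b)).
  rewrite -ih; apply: eq_Ex => w; congr F; apply/funext => i.
  by rewrite /upd /= (inj_eq hi).
by rewrite !E.
Qed.

Section BK.
Implicit Type f : (I -> bool) -> (I -> bool) -> Prop.

Definition increasing2 f := forall a b a' b' : I -> bool,
  (forall e, a e -> a' e) -> (forall e, b e -> b' e) -> f a b -> f a' b'.

Definition disjointly f w := exists a b : I -> bool,
  [/\ forall e, a e -> w e, forall e, b e -> w e,
      forall e, a e -> b e -> False & f a b].

(* The inequality of van den Berg and Kesten, for a relation which need not be
   a product: one coordinate at a time, sharing the coordinate between the two
   arguments is less likely to be useful than having two independent copies. *)
Lemma BK_relation p s f : 0 <= p <= 1 -> increasing2 f ->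
  Ex p s (fun w => ind (disjointly f w)) <=
  Ex p s (fun w => Ex p s (fun w' => ind (f w w'))).
Proof.
move=> p01; have /andP[p0 p1] := p01; elim: s f => [|e s ih] f fi /=.
  apply: ind_le => -[a [b [aw bw _ fab]]].
  by apply: fi fab => i; [move=> /aw|move=> /bw].
pose g i j a b := f (upd a e i) (upd b e j).
have gi i j : increasing2 (g i j).
  move=> a b a' b' aa' bb'; apply: fi => k; rewrite /upd; case: eqP => // _;
  [exact: aa'|exact: bb'].
have gle (i j i' j' : bool) a b : (i ==> i') -> (j ==> j') -> g i j a b -> g i' j' a b.
  by move=> ii' jj'; apply: fi => k; rewrite /upd; case: eqP => // _; exact/implyP.
(* An open [e] can be given to only one of the two arguments, so disjoint occurrence with [e] open
   reduces to disjoint occurrence of the alternative [h] on [s]. *)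
pose h a b := g true false a b \/ g false true a b.
have hi : increasing2 h.
  by move=> a b a' b' aa' bb' [H|H]; [left|right]; exact: gi H.
have le1 : Ex p s (fun w => ind (disjointly f (upd w e true))) <=
           Ex p s (fun w => ind (disjointly h w)).
  apply: le_Ex => // w; apply: ind_le => -[a [b [aw bw ab fab]]].
  exists (upd a e false), (upd b e false); split.
  - by move=> k; have := aw k; rewrite /upd; case: eqP.
  - by move=> k; have := bw k; rewrite /upd; case: eqP.
  - by move=> k; have := ab k; rewrite /upd; case: eqP.
  rewrite /h /g !upd_upd; have {}fab : g (a e) (b e) a b by rewrite /g !upd_id.
  have : ~~ (a e && b e) by apply/negP => /andP[/ab].
  by case: (a e) (b e) fab => [] [] fab // _; [left|right|left];
    move: fab; apply: gle.
have le0 : Ex p s (fun w => ind (disjointly f (upd w e false))) <=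
           Ex p s (fun w => ind (disjointly (g false false) w)).
  apply: le_Ex => // w; apply: ind_le => -[a [b [aw bw ab fab]]].
  exists a, b; split => //.
  - by move=> k ak; have := aw k ak; rewrite /upd; case: eqP.
  - by move=> k bk; have := bw k bk; rewrite /upd; case: eqP.
  have ae : a e = false.
    by apply/negP => /aw; rewrite /upd eqxx.
  have be : b e = false.
    by apply/negP => /bw; rewrite /upd eqxx.
  by rewrite /g -{1}ae -{1}be !upd_id.
have {le1} le1 := le_trans le1 (ih _ hi).
have {le0} le0 := le_trans le0 (ih _ (gi false false)).
apply: le_trans (lerD (ler_wpM2l p0 le1) (ler_wpM2l _ le0)) _.
  by rewrite subr_ge0.
(* What remains is pointwise in the two copies [a], [b]: a single value of [e], used by at most one
   side, against two independent values of [e]. The cases are which of the sections [g i j] hold. *)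
rewrite -!ExZ -!ExD; apply: le_Ex => // a.
rewrite -!ExZ -!ExD -!ExZ -!ExD.
apply: le_Ex => // b; rewrite -/(g _ _ _ _) /h.
have [f00|f00] := pselect (g false false a b).
  by rewrite !ind_true ?mulr1//; [lra|exact: gle f00..|left; exact: gle f00].
rewrite (ind_false _ f00).
have [f10|f10] := pselect (g true false a b).
  rewrite (ind_true _ f10) (@ind_true _ (g true true a b)); last exact: gle f10.
  rewrite ind_true; last by left.
  have x0 := ind_ge0 R (g false true a b).
  by have := mulr_ge0 (mulr_ge0 (_ : 0 <= 1 - p) p0) x0; rewrite subr_ge0 => /(_ p1); lra.
have [f01|f01] := pselect (g false true a b).
  rewrite (ind_true _ f01) (@ind_true _ (g true true a b)); last exact: gle f01.
  rewrite ind_true; last by right.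
  by rewrite (ind_false _ f10); lra.
rewrite (@ind_false _ (_ \/ _)); last by case.
have x0 := ind_ge0 R (g true true a b).
by have := mulr_ge0 (mulr_ge0 p0 p0) x0; rewrite (ind_false _ f10) (ind_false _ f01); lra.
Qed.

End BK.

Definition increasing_event (A : (I -> bool) -> Prop) :=
  forall w w', (forall e, w e -> w' e) -> A w -> A w'.

Lemma ind_and (P Q : Prop) : ind (P /\ Q) = ind P * ind Q :> R.
Proof. by rewrite /ind asbool_and -mulnb natrM. Qed.

Lemma BK p s (A B : (I -> bool) -> Prop) : 0 <= p <= 1 ->
  increasing_event A -> increasing_event B ->
  Ex p s (fun w => ind (disjointly (fun a b => A a /\ B b) w)) <=
  Ex p s (fun w => ind (A w)) * Ex p s (fun w => ind (B w)).
Proof.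
move=> p01 Ai Bi; apply: le_trans (BK_relation _ p01 _) _.
  by move=> a b a' b' aa' bb' [Aa Bb]; split; [exact: Ai Aa|exact: Bi Bb].
rewrite mulrC -ExZ; apply: le_Ex => // w.
by rewrite mulrC -ExZ; apply: le_Ex => // w'; rewrite ind_and.
Qed.

(** Two applications of [BK]: the disjoint occurrence of [B] and [C] is itself an increasing
    event. *)
Lemma BK3 p s (A B C : (I -> bool) -> Prop) : 0 <= p <= 1 ->
  increasing_event A -> increasing_event B -> increasing_event C ->
  Ex p s (fun w => ind (exists a b c : I -> bool,
    [/\ forall e, a e -> w e, forall e, b e -> w e & forall e, c e -> w e] /\
    [/\ forall e, a e -> b e -> False, forall e, a e -> c e -> False &
        forall e, b e -> c e -> False] /\ [/\ A a, B b & C c])) <=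
  Ex p s (fun w => ind (A w)) * Ex p s (fun w => ind (B w)) *
  Ex p s (fun w => ind (C w)).
Proof.
move=> p01 Ai Bi Ci.
pose D := disjointly (fun a b => B a /\ C b).
have Di : increasing_event D.
  by move=> w w' ww' [a [b [aw bw ab H]]]; exists a, b; split => // e;
    [move=> /aw/ww'|move=> /bw/ww'].
rewrite -mulrA; apply: (@le_trans _ _ (Ex p s (fun w => ind (A w)) *
  Ex p s (fun w => ind (D w)))); last first.
  by rewrite ler_wpM2l ?BK//; apply: Ex_ge0 => // w; exact: ind_ge0.
apply: le_trans (BK _ p01 Ai Di); apply: le_Ex => // w; apply: ind_le.
move=> [a [b [c [[aw bw cw] [[ab ac bc] [Aa Bb Cc]]]]]].
exists a, (fun e => b e || c e); split => //.
- by move=> e /orP[/bw|/cw].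
- by move=> e ae /orP[/ab|/ac]; apply.
- by split => //; exists b, c; split => // e ->; rewrite ?orbT.
Qed.

Lemma Ex_indep1 p s h (g : bool -> R) e : uniq s -> e \in s ->
  (forall w b, h (upd w e b) = h w) ->
  Ex p s (fun w => h w * g (w e)) =
  Ex p s h * (p * g true + (1 - p) * g false).
Proof.
elim: s h => [//|e' s ih] h /= /andP[e's us]; rewrite inE => /predU1P[<-|es] he.
  have E b : Ex p s (fun w => h (upd w e b) * g (upd w e b e)) = g b * Ex p s h.
    by rewrite -ExZ; apply: eq_Ex => w; rewrite he /upd eqxx mulrC.
  have E' b : Ex p s (fun w => h (upd w e b)) = Ex p s h.
    by apply: eq_Ex => w; rewrite he.
  by rewrite !E !E'; ring.
have ee' : e != e' by apply: contraNneq e's => <-.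
have E b : Ex p s (fun w => h (upd w e' b) * g (upd w e' b e)) =
    Ex p s (fun w => h (upd w e' b)) * (p * g true + (1 - p) * g false).
  rewrite -ih//.
    by apply: eq_Ex => w; rewrite {2}/upd (negbTE ee').
  by move=> w c; rewrite updC// he.
by rewrite !E; ring.
Qed.

(* [T w] is the set of coordinates queried by an algorithm run on [w]. *)
Definition stopping (T : (I -> bool) -> I -> bool) F := forall w w',
  (forall e, T w e -> w e = w' e) -> T w' =1 T w /\ F w' = F w.

(** Likelihood ratios are needed only at queried coordinates: whether [e] is queried does not depend
    on its own value, and an unqueried [e] does not influence [F]. The statement covers arbitrary
    real [F] because the induction multiplies [F] by the indicator that [e] is, or is not,
    queried. *)
Lemma Ex_change_of_law p q s (T : (I -> bool) -> I -> bool) F (r : bool -> R) :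
  uniq s -> p = q * r true -> 1 - p = (1 - q) * r false -> stopping T F ->
  Ex q s (fun w => F w * \prod_(e <- s | T w e) r (w e)) = Ex p s F.
Proof.
move=> us pq pq'; elim: s us T F => [|e s ih] /= us T F TF.
  by rewrite big_nil mulr1.
move: us => /andP[es us].
have TFe (c : bool) b : stopping (fun w => T (upd w e b))
    (fun w => (T (upd w e b) e == c)%:R * F (upd w e b)).
  move=> w w' ww'; have [i|TT ->] := TF (upd w e b) (upd w' e b).
    by move=> Ti; rewrite /upd; case: eqP => // _; exact: ww'.
  by split => //; rewrite TT.
have Tind w c : T (upd w e c) e = T w e.
  have [Te|nTe] := boolP (T w e); last first.
    have [|-> _] := TF w (upd w e c); last exact/negbTE.
    by move=> i Ti; rewrite /upd; case: eqP => // ie; move: Ti; rewrite ie (negbTE nTe).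
  apply/negPn/negP => nTe; have [|TT _] := TF (upd w e c) w.
    by move=> i Ti; rewrite /upd; case: eqP => // ie; move: Ti; rewrite ie (negbTE nTe).
  by move: nTe; rewrite -TT Te.
have Find w c : ~~ T w e -> F (upd w e c) = F w.
  move=> nTe; have [|_ ->//] := TF w (upd w e c).
  by move=> i Ti; rewrite /upd; case: eqP => // ie; move: Ti; rewrite ie (negbTE nTe).
have E b : Ex q s (fun w => F (upd w e b) *
    \prod_(i <- e :: s | T (upd w e b) i) r (upd w e b i)) =
    Ex p s (fun w => (T w e == false)%:R * F (upd w e true)) +
    r b * Ex p s (fun w => (T w e == true)%:R * F (upd w e b)).
  have -> : Ex p s (fun w => (T w e == false)%:R * F (upd w e true)) =
            Ex p s (fun w => (T (upd w e b) e == false)%:R * F (upd w e b)).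
    apply: eq_Ex => w; rewrite Tind; have [Te|nTe] := boolP (T w e).
      by rewrite !mul0r.
    by rewrite !Find.
  have -> : Ex p s (fun w => (T w e == true)%:R * F (upd w e b)) =
            Ex p s (fun w => (T (upd w e b) e == true)%:R * F (upd w e b)).
    by apply: eq_Ex => w; rewrite Tind.
  rewrite -(ih us _ _ (TFe false b)) -(ih us _ _ (TFe true b)) -ExZ -ExD.
  apply: eq_Ex => w; rewrite big_cons Tind.
  have -> : \prod_(i <- s | T (upd w e b) i) r (upd w e b i) =
            \prod_(i <- s | T (upd w e b) i) r (w i).
    rewrite big_seq_cond [RHS]big_seq_cond; apply: eq_bigr => i /andP[si _].
    by rewrite /upd; case: eqP => // ie; move: es; rewrite -ie si.
  by case: (T w e) => /=; rewrite ?eqxx ?{1}/upd ?eqxx; ring.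
rewrite !E.
have E' b : Ex p s (fun w => F (upd w e b)) =
    Ex p s (fun w => (T w e == false)%:R * F (upd w e true)) +
    Ex p s (fun w => (T w e == true)%:R * F (upd w e b)).
  rewrite -ExD; apply: eq_Ex => w; have [Te|nTe] := boolP (T w e).
    by rewrite mul0r add0r mul1r.
  by rewrite mul0r addr0 mul1r !Find.
rewrite !E'.
set X := Ex p s _; set Y := Ex p s _; set Z := Ex p s _.
transitivity (X + (q * r true) * Y + ((1 - q) * r false) * Z); first by ring.
by rewrite -pq -pq'; ring.
Qed.

End bernoulli_expectation.

(** * Relative entropy and second moments *)

Section product_law.
Context {R : realType} {I : choiceType}.
Implicit Types (s r : seq I) (p q : R) (A : (I -> bool) -> Prop).

Definition determined_by s A := forall w w' : I -> bool,
  {in s, w =1 w'} -> A w -> A w'.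

Let measurable_cylinder s (b : I -> bool) :
  measurable [set w : config I | {in s, forall i, w i = b i}].
Proof.
elim: s => [|e s ih].
  by rewrite [X in measurable X](_ : _ = setT)//; apply/seteqP; split.
rewrite [X in measurable X](_ : _ =
  (if b e then [set w : config I | w e] else ~` [set w : config I | w e]) `&`
  [set w : config I | {in s, forall i, w i = b i}]); last first.
  apply/seteqP; split => [w H|w [H1 H2] i].
    split; last by move=> i si; apply: H; rewrite inE si orbT.
    have := H e (mem_head _ _).
    by case: (b e) => //= /negbT/negP.
  rewrite inE => /predU1P[->|/H2//].
  by move: H1; case: (b e) => //= /negP/negbTE.
apply: measurableI => //.
have mo : measurable [set w : config I | w e].
  by apply: sub_sigma_algebra; exists e.
by case: (b e) => //; exact: measurableC.
Qed.

Let override r (b w : I -> bool) : I -> bool := fun i => if i \in r then b i else w i.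

(** The coordinates in [r] are frozen to [b] and those in [s] are still averaged; the induction
    moves the head of [s] into [r] until only a cylinder is left. *)
Let law_step p (P : probability (config I) R) A s r (b : I -> bool) :
  is_bernoulli_product p P -> uniq (r ++ s) -> determined_by (r ++ s) A ->
  let B := [set w : config I | {in r, forall i, w i = b i} /\ A w] in
  measurable B /\
  P B = ((\prod_(i <- r) (if b i then p else 1 - p)) *
         Ex p s (fun w => ind (A (override r b w))))%:E.
Proof.
move=> PP; elim: s r b => [|e s ih] r b /=.
  rewrite cats0 => ur Ar.
  have [Ab|nAb] := pselect (A (override r b (fun=> false))).
    rewrite (_ : [set w | _] = [set w : config I | {in r, forall i, w i = b i}]).
      split; first exact: measurable_cylinder.
      by rewrite PP// ind_true// mulr1.
    apply/seteqP; split => [w []//|w wb]; split => //.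
    apply: Ar Ab => i ir; rewrite /override ir; exact/esym/wb.
  rewrite (_ : [set w | _] = set0); last first.
    rewrite -subset0 => w [wb Aw]; apply: nAb; apply: Ar Aw => i ir.
    by rewrite /override ir; exact: wb.
  by rewrite ind_false// mulr0 measure0.
move=> urs Ars.
have er : e \notin r.
  by move: urs; rewrite cat_uniq /= => /and3P[_ /norP[]].
have urs' : uniq ((e :: r) ++ s).
  by move: urs; rewrite (perm_uniq (_ : perm_eq (r ++ e :: s) ((e :: r) ++ s)))//=
    perm_catC /= perm_cons perm_catC.
have Ars' : determined_by ((e :: r) ++ s) A.
  move=> w w' ww'; apply: Ars => i; rewrite mem_cat inE => H; apply: ww'.
  by rewrite mem_cat inE; move: H => /or3P[->|->|->]; rewrite ?orbT.
pose B c := [set w : config I | {in e :: r, forall i, w i = upd b e c i} /\ A w].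
have [mBt PBt] := ih (e :: r) (upd b e true) urs' Ars'.
have [mBf PBf] := ih (e :: r) (upd b e false) urs' Ars'.
have -> : [set w : config I | {in r, forall i, w i = b i} /\ A w] =
    B true `|` B false.
  have H c w : B c w -> {in r, forall i, w i = b i} /\ A w.
    move=> [wb Aw]; split => // i ir; rewrite wb ?inE ?ir ?orbT// /upd.
    by case: eqP => // ie; move: er; rewrite -ie ir.
  apply/seteqP; split => [w [wb Aw]|w [|]]; [|exact: H..].
  have : B (w e) w.
    split => // i; rewrite inE /upd => /predU1P[->|ir]; first by rewrite eqxx.
    by case: eqP => [->//|_]; exact: wb.
  by case: (w e); [left|right].
have Bdisj : B true `&` B false = set0.
  rewrite -subset0 => w [[+ _] [+ _]] => /(_ e) + /(_ e).
  by rewrite mem_head /upd eqxx => /(_ erefl) -> /(_ erefl).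
split; first exact: measurableU.
rewrite measureU//.
have E c : Ex p s (fun w => ind (A (override (e :: r) (upd b e c) w))) =
           Ex p s (fun w => ind (A (override r b (upd w e c)))) :> R.
  apply: eq_Ex => w; congr (ind (A _)); apply/funext => i.
  rewrite /override /upd inE; case: eqP => [->|//] /=.
  by rewrite (negbTE er).
have F c : \prod_(i <- r) (if upd b e c i then p else 1 - p) =
           \prod_(i <- r) (if b i then p else 1 - p).
  rewrite big_seq [RHS]big_seq; apply: eq_bigr => i ir; rewrite /upd.
  by case: eqP => // ie; move: er; rewrite -ie ir.
apply: etrans (congr2 (fun x y => (x + y)%E) PBt PBf) _; rewrite !E !big_cons !F {1 3}/upd eqxx.
by rewrite -EFinD; congr EFin; ring.
Qed.

Lemma bernoulli_product_determined p (P : probability (config I) R) A s :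
  is_bernoulli_product p P -> uniq s -> determined_by s A ->
  measurable [set w : config I | A w] /\
  P [set w : config I | A w] = (Ex p s (fun w => ind (A w)))%:E.
Proof.
move=> PP us As; have := @law_step p P A s [::] (fun=> false) PP us As => /=.
have -> : [set w : config I | {in [::], forall i, w i = false} /\ A w] =
          [set w : config I | A w].
  by apply/seteqP; split => [w []//|w Aw]; split.
by rewrite big_nil mul1r.
Qed.

End product_law.

Section entropy.
Context {R : realType} {I : choiceType}.
Implicit Types (s : seq I) (p q : R) (A : (I -> bool) -> Prop).

Lemma ln_le_subr1 (x : R) : 0 < x -> ln x <= x - 1.
Proof.
move=> x0; have := @expR_ge1Dx R (ln x).
by rewrite lnK ?posrE// => h; rewrite lerBrDl.
Qed.

(** The right side is minus the relative entropy of Bernoulli([q]) with respect to Bernoulli([p]),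
    the left side minus their chi-square divergence; $\ln x\le x-1$ compares the two. *)
Lemma bernoulli_entropy p q : 0 < q < 1 -> 0 < p < 1 ->
  - ((p - q) ^+ 2 / (p * (1 - p))) <=
  q * ln (p / q) + (1 - q) * ln ((1 - p) / (1 - q)).
Proof.
move=> /andP[q0 q1] /andP[p0 p1].
have p'0 : 0 < 1 - p by rewrite subr_gt0.
have q'0 : 0 < 1 - q by rewrite subr_gt0.
rewrite -[p / q]invf_div -[(1 - p) / (1 - q)]invf_div !lnV ?posrE ?divr_gt0//.
rewrite !mulrN -opprD lerN2.
apply: (@le_trans _ _ (q * (q / p - 1) + (1 - q) * ((1 - q) / (1 - p) - 1))).
  by apply: lerD; rewrite ler_pM2l// ln_le_subr1// divr_gt0.
rewrite le_eqVlt; apply/orP; left; apply/eqP; field.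
by rewrite !gt_eqF.
Qed.

(* Couple the law of parameter [q] on the queried coordinates with that of
   parameter [p] on the other ones: the relative entropy of this law with
   respect to the law of parameter [p] is proportional to the expected number
   of queries. *)
Lemma entropic_bound p q s (T : (I -> bool) -> I -> bool) A : uniq s ->
  0 < q < 1 -> 0 < p < 1 -> stopping T (fun w => ind (A w) : R) ->
  (1 - expR (-1)) * Ex p s (fun w => ind (A w)) <=
  Ex q s (fun w => ind (A w)) +
  (p - q) ^+ 2 / (p * (1 - p)) * \sum_(e <- s) Ex q s (fun w => (T w e)%:R).
Proof.
move=> us q01 p01 TA; have /andP[q0 q1] := q01; have /andP[p0 p1] := p01.
have p'0 : 0 < 1 - p by rewrite subr_gt0.
have q'0 : 0 < 1 - q by rewrite subr_gt0.
pose r (b : bool) := if b then p / q else (1 - p) / (1 - q).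
have r0 b : 0 < r b by case: b; rewrite divr_gt0.
(* This is the Gibbs variational inequality for $-1_A$: the change of law is tested on $e^{-1_A}$,
   whose expectation is affine in the probability of [A]. *)
have TF : stopping T (fun w => expR (- ind (A w)) : R).
  by move=> w w' ww'; have [? ->] := TA w w' ww'.
have pq : p = q * r true by rewrite /r mulrC divfK ?gt_eqF.
have pq' : 1 - p = (1 - q) * r false by rewrite /r mulrC divfK ?gt_eqF.
have := Ex_change_of_law us pq pq' TF.
have -> : Ex p s (fun w => expR (- ind (A w))) =
    1 - (1 - expR (-1)) * Ex p s (fun w => ind (A w)).
  rewrite -mulNr -ExZ -[X in X + _](Ex_cst p s 1) -ExD; apply: eq_Ex => w.
  have [Aw|nAw] := pselect (A w); first by rewrite !ind_true//; ring.
  by rewrite ind_false// oppr0 expR0; ring.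
move=> E; rewrite -lerN2 -(lerD2l 1) -E.
(* The weighted integrand is an exponential; bounding it below by $1+x$ leaves only the expected
   log-likelihood ratio. *)
apply: (@le_trans _ _ (Ex q s (fun w => (1 - ind (A w)) +
    \sum_(e <- s) ((T w e)%:R * ln (r (w e)))))); last first.
  apply: le_Ex; first by rewrite !ltW.
  move=> w; have -> : \prod_(e <- s | T w e) r (w e) =
      expR (\sum_(e <- s) ((T w e)%:R * ln (r (w e)))).
    rewrite expR_sum big_mkcond; apply: eq_bigr => e _.
    by case: (T w e); rewrite ?mul1r ?lnK ?posrE// mul0r expR0.
  rewrite -expRD; apply: le_trans (expR_ge1Dx _).
  by rewrite addrA.
rewrite ExD Ex_sum.
have -> : Ex q s (fun w => 1 - ind (A w)) = 1 - Ex q s (fun w => ind (A w)).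
  rewrite -mulN1r -ExZ -[X in X + _](Ex_cst q s 1) -ExD; apply: eq_Ex => w.
  by rewrite mulN1r.
rewrite opprD addrA lerD2l -mulNr mulr_sumr big_seq [leRHS]big_seq.
apply: ler_sum => e es.
(* The decision to query [e] does not look at [w e], so it is independent of the log-ratio at
   [e]. *)
rewrite (@Ex_indep1 _ _ _ _ (fun w => (T w e)%:R) (fun b => ln (r b)))//; last first.
  move=> w b; congr (_%:R); congr nat_of_bool.
  have [Te|nTe] := boolP (T w e); last first.
    have [|-> _] := TA w (upd w e b); last exact/negbTE.
    by move=> i Ti; rewrite /upd; case: eqP => // ie; move: Ti; rewrite ie (negbTE nTe).
  apply/negPn/negP => nTe; have [|TT _] := TA (upd w e b) w.
    by move=> i Ti; rewrite /upd; case: eqP => // ie; move: Ti; rewrite ie (negbTE nTe).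
  by move: nTe; rewrite -TT Te.
rewrite mulrC ler_wpM2l//.
  by apply: Ex_ge0; [rewrite !ltW|move=> w; rewrite ler0n].
exact: bernoulli_entropy.
Qed.

(* [k <= lam * 1_(k > 0) + k^2 / lam] for every count [k]. *)
Lemma second_moment_truncation p s (J : eqType) (l : seq J)
    (A : J -> (I -> bool) -> Prop) (lam : R) : 0 <= p <= 1 -> 0 < lam ->
  \sum_(j <- l) Ex p s (fun w => ind (A j w)) <=
  lam * Ex p s (fun w => ind (exists2 j, j \in l & A j w)) +
  lam^-1 * \sum_(i <- l) \sum_(j <- l) Ex p s (fun w => ind (A i w /\ A j w)).
Proof.
move=> p01 lam0; rewrite -Ex_sum.
under eq_bigr do rewrite -Ex_sum.
rewrite -Ex_sum -!ExZ -ExD; apply: le_Ex => // w.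
set X := \sum_(j <- l) _.
have -> : \sum_(i <- l) \sum_(j <- l) ind (A i w /\ A j w) = X ^+ 2.
  rewrite expr2 mulr_suml; apply: eq_bigr => i _.
  by rewrite mulr_sumr; apply: eq_bigr => j _; rewrite ind_and.
have [[j jl Ajw]|noA] := pselect (exists2 j, j \in l & A j w); last first.
  have -> : X = 0.
    rewrite /X big_seq big1// => j jl; rewrite ind_false// => Aj.
    by apply: noA; exists j.
  by rewrite expr0n mulr0 addr0 mulr_ge0 ?ind_ge0// ltW.
rewrite ind_true; last by exists j.
have X0 : 0 <= X by apply: sumr_ge0 => i _; exact: ind_ge0.
rewrite mulr1 -(ler_pM2l lam0) mulrDr mulrA divff ?gt_eqF// mul1r.
by nra.
Qed.

End entropy.

(** * Open paths *)

Section path_splitting.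
Context {T : eqType}.
Implicit Types (x y : T) (s : seq T) (Q : pred T).

Lemma first_exit Q x s : Q x -> ~~ Q (last x s) ->
  exists s1 y s2, [/\ s = s1 ++ y :: s2, all Q (x :: s1) & ~~ Q y].
Proof.
elim: s x => [|y s ih] x Qx /=; first by rewrite Qx.
have [Qy|nQy] := boolP (Q y); last first.
  by exists [::], y, s; rewrite /= Qx.
move=> /(ih _ Qy)[s1 [z [s2 [-> As1 nQz]]]].
by exists (y :: s1), z, s2; split => //=; rewrite Qx.
Qed.

Lemma first_hit Q x s : Q (last x s) ->
  exists s1 s2, [/\ s = s1 ++ s2, Q (last x s1) & all (predC Q) (belast x s1)].
Proof.
elim: s x => [|y s ih] x /=; first by move=> Qx; exists [::], [::].
have [Qx _|nQx] := boolP (Q x); first by exists [::], (y :: s).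
by move=> /ih[s1 [s2 [-> Qs1 As1]]]; exists (y :: s1), s2; split => //=; rewrite nQx.
Qed.

Lemma lowest_point (h : T -> int) x s :
  exists2 y, y \in x :: s & forall z, z \in x :: s -> h y <= h z.
Proof.
elim: s x => [|y s ih] x.
  by exists x; rewrite ?mem_head// => z; rewrite inE => /eqP ->.
have [z zs H] := ih y; have [hz|hz] := leP (h x) (h z).
  exists x; rewrite ?mem_head// => t; rewrite inE => /predU1P[->//|/H].
  exact: le_trans.
exists z; first by rewrite inE zs orbT.
by move=> t; rewrite inE => /predU1P[->|/H//]; exact: ltW.
Qed.

End path_splitting.

Section connection_events.
Context {d L : nat}.
Local Notation V := 'rV[int]_d.+1.
Local Notation E := (edges L : set (set V)).
Local Notation conf := (config E).
Implicit Types (w : conf) (x y z a b : V) (s : seq V) (S D U A B : set V) (e : E).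

Definition open_path w x s := path (fun u v => `[< open_edge w u v >]) x s.

Lemma set2_inj (x y x' y' : V) : [set x; y] = [set x'; y'] ->
  (x = x' /\ y = y') \/ (x = y' /\ y = x').
Proof.
move=> H.
have hx : [set x'; y'] x by rewrite -H; left.
have hy : [set x'; y'] y by rewrite -H; right.
have hx' : [set x; y] x' by rewrite H; left.
have hy' : [set x; y] y' by rewrite H; right.
by case: hx => ?; case: hy => ?; case: hx' => ?; case: hy' => ?; subst; auto.
Qed.

Lemma adjacentP x y : Defs.adjacent L x y <-> x <> y /\ `|x - y| <= L%:Z.
Proof.
split=> [[x' [y' [nxy xyL]]]|[nxy xyL]]; last by exists x, y.
by move=> /set2_inj[[-> ->]//|[-> ->]]; split; [move=> yx; apply: nxy|rewrite distrC].
Qed.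

Lemma open_edge_sym w x y : open_edge w x y -> open_edge w y x.
Proof. by move=> [e eE we]; exists e => //; rewrite eE setUC. Qed.

Lemma open_edge_adjacent w x y : open_edge w x y -> Defs.adjacent L x y.
Proof. by move=> [e eE _]; rewrite /Defs.adjacent -eE; exact: set_valP. Qed.

Lemma edge_ends e : exists x y, x <> y /\ val e = [set x; y].
Proof. by have [x [y [xy _ eE]]] := set_valP e; exists x, y. Qed.

(** The witnesses handed to the BK inequality: a piece of path with vertex set [U] is still open in
    [restr U w], so disjointness of edges becomes a condition on vertex sets. *)
Definition restr U w : conf := fun e => w e && `[< val e `<=` U >].

Lemma restr_le U w e : restr U w e -> w e.
Proof. by case/andP. Qed.

(* It suffices to share at most one vertex: see [restr_disjoint]. *)
Definition edge_disjoint (U U' : set V) := forall x y, U x -> U' x -> U y -> U' y -> x = y.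

Lemma restr_disjoint (U U' : set V) w e : edge_disjoint U U' ->
  restr U w e -> restr U' w e -> False.
Proof.
move=> UU' /andP[_ /asboolP eU] /andP[_ /asboolP eV].
have [x [y [nxy eE]]] := edge_ends e; apply: nxy.
by apply: UU'; [apply: eU|apply: eV|apply: eU|apply: eV]; rewrite eE; [left|left|right|right].
Qed.

Lemma open_path_sub w w' x s :
  (forall e, val e `<=` [set` x :: s] -> w e -> w' e) ->
  open_path w x s -> open_path w' x s.
Proof.
rewrite /open_path; elim: s x => [//|y s ih] x H /= /andP[/asboolP[e eE we] ps].
apply/andP; split.
  apply/asboolP; exists e => //; apply: H we.
  by rewrite eE => z [->|->] /=; rewrite !inE eqxx ?orbT.
apply: ih ps => f fs; apply: H => z /fs /=.
by rewrite [in X in _ -> X]inE => ->; rewrite orbT.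
Qed.

Lemma connected_in_mono w (w' : conf) S (S' : set V) A (A' : set V)
    B (B' : set V) : (forall e, w e -> w' e) ->
  S `<=` S' -> A `<=` A' -> B `<=` B' ->
  connected_in w S A B -> connected_in w' S' A' B'.
Proof.
move=> ww' SS AA BB [x [s [Ax Bx Ss ps]]]; exists x, s; split.
- exact: AA.
- exact: BB.
- by move=> z /Ss; exact: SS.
- by apply: (@open_path_sub w) => // e _; exact: ww'.
Qed.

Lemma connected_in_sub w S (S' : set V) A (A' : set V) B (B' : set V) :
  S `<=` S' -> A `<=` A' -> B `<=` B' ->
  connected_in w S A B -> connected_in w S' A' B'.
Proof. exact: connected_in_mono. Qed.

Lemma connected_in_refl w D a : D a -> connected_in w D [set a] [set a].
Proof. by move=> Da; exists a, [::]; split => // z; rewrite inE => /eqP ->. Qed.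

Lemma connected_in_sym w D x y :
  connected_in w D [set x] [set y] -> connected_in w D [set y] [set x].
Proof.
move=> [_ [s [-> + Ds ps]]] => /= ly; exists y, (rev (belast x s)); split => //.
- by case: s ly {Ds ps} => [/= <-|z s _] //=; rewrite rev_cons last_rcons.
- move=> z; rewrite -[y]ly inE mem_rev => /predU1P[->|/mem_belast]; apply: Ds.
  exact: mem_last.
- rewrite -[y]ly rev_path; apply: sub_path ps => u v /asboolP uv.
  by apply/asboolP; exact: open_edge_sym.
Qed.

Lemma connected_in_end w D A B : connected_in w D A B ->
  exists a b, [/\ A a, B b, D a, D b & connected_in w D [set a] [set b]].
Proof.
move=> [x [s [Ax Bx Ds ps]]]; exists x, (last x s); split => //.
- by apply: Ds; exact: mem_head.
- by apply: Ds; exact: mem_last.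
- by exists x, s; split.
Qed.

Lemma connected_in_step w D a x y : connected_in w D [set a] [set x] -> D y ->
  open_edge w x y -> connected_in w D [set a] [set y].
Proof.
move=> [_ [s [-> lx Ds ps]]] Dy xy; exists a, (rcons s y); split => //.
- by rewrite last_rcons.
- move=> z; rewrite inE mem_rcons inE orbCA => /predU1P[->//|]; exact: Ds.
- by rewrite rcons_path ps lx; exact/asboolP.
Qed.

Lemma connected_in_uniq w D A B : connected_in w D A B ->
  exists a s, [/\ A a, B (last a s), forall z, z \in a :: s -> D z,
                  open_path w a s & uniq (a :: s)].
Proof.
move=> [a [s [Aa + Ds ps]]]; case/shortenP: ps => s' ps' us' ss' Bs'.
exists a, s'; split => // z; rewrite inE => /predU1P[->|/ss' zs].
  by apply: Ds; exact: mem_head.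
by apply: Ds; rewrite inE zs orbT.
Qed.

Lemma connected_in_restr w D a s b (U : set V) : last a s = b ->
  (forall z, z \in a :: s -> D z) -> (forall z, z \in a :: s -> U z) ->
  open_path w a s -> connected_in (restr U w) D [set a] [set b].
Proof.
move=> lb Ds Us ps; exists a, s; split => //.
apply: open_path_sub ps => e es we; rewrite /restr we; apply/asboolP => z /es.
exact: Us.
Qed.

(** Cut a self-avoiding path at its first exit from [S]: the piece inside, the crossing edge and the
    rest pairwise share at most one vertex. *)
Lemma exit_witness w S D a B : S a -> (forall b, B b -> ~ S b) ->
  connected_in w D [set a] B ->
  exists x y, [/\ S x, D x, D y, ~ S y & Defs.adjacent L x y] /\
  exists U1 U2 U3, [/\ edge_disjoint U1 U2, edge_disjoint U1 U3 &
    edge_disjoint U2 U3] /\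
  [/\ connected_in (restr U1 w) (S `&` D) [set a] [set x],
      open_edge (restr U2 w) x y & connected_in (restr U3 w) D [set y] B].
Proof.
move=> Sa BS /connected_in_uniq[_ [s [-> Bs Ds ps us]]].
have Sa' : a \in S by rewrite inE.
have nSl : last a s \notin S by apply/negP; rewrite inE => /(BS _ Bs).
have [s1 [y [s2 [sE /allP Ss1 nSy]]]] := first_exit Sa' nSl.
have s12 z : z \in a :: s1 -> z \in y :: s2 -> False.
  move: us; rewrite sE -cat_cons cat_uniq => /and3P[_ /hasPn hs _] z1 /hs.
  by move=> /negP; apply.
move: ps Bs Ds; rewrite sE last_cat /open_path cat_path /=.
move=> /and3P[ps1 /asboolP oxy ps2] Bs Ds.
have Ds1 z : z \in a :: s1 -> D z.
  by move=> zs; apply: Ds; rewrite -cat_cons mem_cat zs.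
have Ds2 z : z \in y :: s2 -> D z.
  by move=> zs; apply: Ds; rewrite -cat_cons mem_cat zs orbT.
exists (last a s1), y; split.
  split.
  - by have := Ss1 _ (mem_last a s1); rewrite inE.
  - exact/Ds1/mem_last.
  - exact/Ds2/mem_head.
  - by move=> Sy; move: nSy; rewrite notin_setE.
  - exact: open_edge_adjacent oxy.
exists [set` a :: s1], [set last a s1; y], [set` y :: s2]; split; split.
- by move=> u v /= us1 [->|uy]; [|by case: (s12 u us1); rewrite uy mem_head] => vs1
   [->//|vy]; case: (s12 v vs1); rewrite vy mem_head.
- by move=> u v us1 /s12-/(_ us1).
- move=> u v [->|->] us2; first by case: (s12 _ (mem_last a s1) us2).
  by move=> [->|->//] vs2; case: (s12 _ (mem_last a s1) vs2).
- apply: (@connected_in_restr _ _ _ s1) => // z zs; split; last exact: Ds1.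
  by have := Ss1 z zs; rewrite inE.
- have [e eE we] := oxy; exists e => //; rewrite /restr we; apply/asboolP.
  by rewrite eE.
- have := @connected_in_restr w D y s2 _ [set` y :: s2] erefl Ds2 (fun=> id) ps2.
  by apply: connected_in_sub => // _ ->.
Qed.

(** Take a self-avoiding path from [a] to [x] and stop a path from [y] towards [a] when it first
    meets it, at [z]: the three branches pairwise meet only at [z]. *)
Lemma tree_witness w D a x y : connected_in w D [set a] [set x] ->
  connected_in w D [set a] [set y] ->
  exists2 z, D z & exists U1 U2 U3, [/\ edge_disjoint U1 U2, edge_disjoint U1 U3 &
    edge_disjoint U2 U3] /\
  [/\ connected_in (restr U1 w) D [set a] [set z],
      connected_in (restr U2 w) D [set z] [set x] &
      connected_in (restr U3 w) D [set z] [set y]].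
Proof.
move=> /connected_in_uniq[_ [s [-> lx Ds ps us]]] /connected_in_sym.
move=> [_ [t [-> lt Dt pt]]].
have /first_hit[t1 [t2 [tE zs At]]] : last y t \in a :: s.
  by rewrite lt mem_head.
set z := last y t1 in zs.
move: Dt pt {lt}; rewrite tE /open_path cat_path => Dt /andP[pt1 _].
have Dt1 v : v \in y :: t1 -> D v.
  by move=> vt; apply: Dt; rewrite -cat_cons mem_cat vt.
have t1s v : v \in y :: t1 -> v \in a :: s -> v = z.
  rewrite lastI mem_rcons inE => /predU1P[->//|vt] vs.
  by have : ~~ (v \in a :: s) := allP At v vt; rewrite vs.
case: (splitPl zs) => s1 s2 zE in lx Ds ps us t1s *.
move: lx ps us; rewrite last_cat /open_path cat_path -cat_cons cat_uniq zE.
move=> lx /andP[ps1 ps2] /and3P[_ hs _].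
have Ds1 v : v \in a :: s1 -> D v.
  by move=> vs; apply: Ds; rewrite -cat_cons mem_cat vs.
have zs1 : z \in a :: s1 by rewrite -zE mem_last.
have zs2 v : v \in z :: s2 -> v \in (a :: s1) ++ s2.
  by rewrite mem_cat inE => /predU1P[->|->]; rewrite ?zs1 ?orbT.
have Ds2 v : v \in z :: s2 -> D v by move=> /zs2; exact: Ds.
have s12 v : v \in a :: s1 -> v \in z :: s2 -> v = z.
  rewrite [v \in z :: _]inE => v1 /predU1P[//|v2].
  by move/hasPn: hs => /(_ v v2) /=; rewrite v1.
exists z; first exact: Ds1.
exists [set` a :: s1], [set` z :: s2], [set` y :: t1]; split; split.
- by move=> u v u1 u2 v1 v2; rewrite (s12 u u1 u2) (s12 v v1 v2).
- have H v : v \in a :: s1 -> v \in y :: t1 -> v = z.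
    by move=> v1 v2; apply: t1s => //; rewrite -cat_cons mem_cat v1.
  by move=> u v u1 u2 v1 v2; rewrite (H u u1 u2) (H v v1 v2).
- have H v : v \in z :: s2 -> v \in y :: t1 -> v = z.
    by move=> /zs2 v1 v2; apply: t1s.
  by move=> u v u1 u2 v1 v2; rewrite (H u u1 u2) (H v v1 v2).
- exact: (@connected_in_restr _ _ _ s1).
- exact: (@connected_in_restr _ _ _ s2).
- by apply: connected_in_sym; exact: (@connected_in_restr _ _ _ t1).
Qed.

(** Cutting at a lowest vertex [z] puts both pieces in a half-space with [z] on its boundary, where
    the half-space estimates apply. *)
Lemma lowest_witness (h : V -> int) w D a b : connected_in w D [set a] [set b] ->
  exists2 z, D z /\ h z <= h a & exists U1 U2, edge_disjoint U1 U2 /\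
  let D' := D `&` [set v | h z <= h v] in
  connected_in (restr U1 w) D' [set a] [set z] /\
  connected_in (restr U2 w) D' [set z] [set b].
Proof.
move=> /connected_in_uniq[_ [s [-> lb Ds ps us]]].
have [z zs hz] := lowest_point h a s.
case: (splitPl zs) => s1 s2 zE in lb Ds ps us hz *.
move: lb ps us; rewrite last_cat /open_path cat_path -cat_cons cat_uniq zE.
move=> lb /andP[ps1 ps2] /and3P[_ hs _].
have zs1 : z \in a :: s1 by rewrite -zE mem_last.
have zs2 v : v \in z :: s2 -> v \in (a :: s1) ++ s2.
  by rewrite mem_cat inE => /predU1P[->|->]; rewrite ?zs1 ?orbT.
have s12 v : v \in a :: s1 -> v \in z :: s2 -> v = z.
  rewrite [v \in z :: _]inE => v1 /predU1P[//|v2].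
  by move/hasPn: hs => /(_ v v2) /=; rewrite v1.
have s1s v : v \in a :: s1 -> v \in (a :: s1) ++ s2 by rewrite mem_cat => ->.
exists z; first by split; [apply: Ds; exact: s1s|exact/hz/mem_head].
exists [set` a :: s1], [set` z :: s2]; split.
  by move=> u v u1 u2 v1 v2; rewrite (s12 u u1 u2) (s12 v v1 v2).
split.
- by apply: (@connected_in_restr _ _ _ s1) => // v /s1s vs; split;
    [exact: Ds|exact: hz].
- by apply: (@connected_in_restr _ _ _ s2) => // v /zs2 vs; split;
    [exact: Ds|exact: hz].
Qed.

(** Stopping at the first vertex outside [C] makes an arm in an unbounded domain depend only on [C]
    and its neighbours. *)
Lemma connected_in_truncate w S C A B : A `<=` C -> (forall b, B b -> ~ C b) ->
  connected_in w S A B ->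
  connected_in w (S `&` [set z | C z \/ exists2 x, C x & Defs.adjacent L x z])
    A (~` C).
Proof.
move=> AC BC [a [s [Aa Bs Ss ps]]].
have Ca : a \in C by rewrite inE; exact: AC.
have nCl : last a s \notin C by apply/negP; rewrite inE => /(BC _ Bs).
have [s1 [y [s2 [sE /allP Cs1 nCy]]]] := first_exit Ca nCl.
move: ps Ss; rewrite sE cat_path /= => /and3P[ps1 /asboolP oxy _] Ss.
exists a, (rcons s1 y); split => //.
- by rewrite last_rcons /setC /= => Cy; move: nCy; rewrite notin_setE.
- move=> z; rewrite -rcons_cons mem_rcons inE => /predU1P[->|zs1].
    split; first by apply: Ss; rewrite inE mem_cat mem_head !orbT.
    right; exists (last a s1); last exact: open_edge_adjacent oxy.
    by have := Cs1 _ (mem_last a s1); rewrite inE.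
  split; first by apply: Ss; rewrite -cat_cons mem_cat zs1.
  by left; have := Cs1 z zs1; rewrite inE.
- by rewrite rcons_path ps1; exact/asboolP.
Qed.

Section automorphism.
Context (g : V -> V).
Hypothesis g_isometry : forall x y, `|g x - g y| = `|x - y|.

Lemma isometry_inj : injective g.
Proof.
move=> x y gxy; apply/eqP; rewrite -subr_eq0 -normr_eq0 -g_isometry.
by rewrite gxy subrr normr0.
Qed.

(** Pulling a configuration back along the injective edge map [h] keeps the edges independent with
    the same parameter; this is how [cprob_isometry] gets invariance. *)
Lemma isometry_edges : exists h : E -> E, injective h /\
  forall w D A B, connected_in (w \o h : conf) D A B ->
  connected_in w (g @` D) (g @` A) (g @` B).
Proof.
have [h hE] : {h : E -> E & forall e, val (h e) = g @` val e}.
  apply: (@choice _ _ (fun e e' : E => val e' = g @` val e)) => e.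
  have [x [y [nxy xyL eE]]] := set_valP e.
  have ge : (edges L : set (set V)) (g @` val e).
    exists (g x), (g y); split => //; first by move/isometry_inj.
      by rewrite g_isometry.
    by rewrite eE image_setU !image_set1.
  by exists (@exist _ (fun A => A \in (edges L : set (set V))) _ (mem_set ge)).
exists h; split.
  move=> e e' hee; apply: val_inj.
  have gg : g @` val e = g @` val e' by rewrite -!hE hee.
  apply/seteqP; split => z ez.
    by have [z' ez' /isometry_inj <-] : (g @` val e') (g z) by rewrite -gg; exists z.
  by have [z' ez' /isometry_inj <-] : (g @` val e) (g z) by rewrite gg; exists z.
move=> w D A B [a [s [Aa Bs Ds ps]]]; exists (g a), (map g s); split.
- by exists a.
- by rewrite last_map; exists (last a s).
- by move=> _ /(mapP (s := a :: s))[z /Ds Dz ->]; exists z.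
- rewrite path_map; apply: sub_path ps => u v /asboolP[e eE we]; apply/asboolP.
  by exists (h e) => //; rewrite hE eE image_setU !image_set1.
Qed.

End automorphism.

End connection_events.

(** * Connection probabilities in finite domains *)

Section sums.
Context {R : realType}.

Lemma ler_sum_seq (J : eqType) (l : seq J) (Q : pred J) (f g : J -> R) :
  (forall j, j \in l -> Q j -> f j <= g j) ->
  \sum_(j <- l | Q j) f j <= \sum_(j <- l | Q j) g j.
Proof.
move=> fg; rewrite [leLHS]big_seq_cond [leRHS]big_seq_cond.
by apply: ler_sum => j /andP[]; exact: fg.
Qed.

Lemma ler_sum_subset (K : eqType) (l m : seq K) (g : K -> R) :
  uniq l -> {subset l <= m} -> (forall k, 0 <= g k) ->
  \sum_(k <- l) g k <= \sum_(k <- m) g k.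
Proof.
elim: l m => [|k l ih] m /=; first by move=> *; rewrite big_nil sumr_ge0.
move=> /andP[kl ul] klm g0; have km := klm k (mem_head _ _).
rewrite big_cons (perm_big _ (perm_to_rem km)) big_cons lerD2l; apply: ih => //.
move=> i il; have := klm i; rewrite inE il orbT => /(_ isT).
rewrite (perm_mem (perm_to_rem km)) inE => /predU1P[ik|//].
by move: kl; rewrite -ik il.
Qed.

Lemma ler_sum_inj (J K : eqType) (l : seq J) (m : seq K) (Q : pred J)
    (h : J -> K) (f : J -> R) (g : K -> R) : uniq l ->
  (forall i j, i \in l -> j \in l -> Q i -> Q j -> h i = h j -> i = j) ->
  (forall j, j \in l -> Q j -> h j \in m /\ f j <= g (h j)) ->
  (forall k, 0 <= g k) ->
  \sum_(j <- l | Q j) f j <= \sum_(k <- m) g k.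
Proof.
move=> ul hi hf g0; apply: (@le_trans _ _ (\sum_(k <- [seq h j | j <- l & Q j]) g k)).
  rewrite big_map big_filter [leLHS]big_seq_cond [leRHS]big_seq_cond.
  by apply: ler_sum => j /andP[jl Qj]; have [] := hf j jl Qj.
apply: ler_sum_subset => //.
  rewrite map_inj_in_uniq ?filter_uniq// => i j; rewrite !mem_filter.
  by move=> /andP[Qi il] /andP[Qj jl]; exact: hi.
by move=> k /mapP[j]; rewrite mem_filter => /andP[Qj jl] ->; have [] := hf j jl Qj.
Qed.

Lemma sum_le_esum (J : eqType) (K : choiceType) (l : seq J) (S : set K) (Q : pred J)
    (h : J -> K) (f : J -> R) (g : K -> \bar R) : uniq l ->
  (forall i j, i \in l -> j \in l -> Q i -> Q j -> h i = h j -> i = j) ->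
  (forall j, j \in l -> Q j -> S (h j) /\ ((f j)%:E <= g (h j))%E) ->
  (forall k, (0 <= g k)%E) ->
  ((\sum_(j <- l | Q j) f j)%:E <= \esum_(k in S) g k)%E.
Proof.
move=> ul hi hf g0; pose m := [seq h j | j <- l & Q j].
have um : uniq m.
  rewrite map_inj_in_uniq ?filter_uniq// => i j; rewrite !mem_filter.
  by move=> /andP[Qi il] /andP[Qj jl]; exact: hi.
apply: esum_ge; exists [set` m].
  split; first exact: finite_seq.
  by move=> k /= /mapP[j]; rewrite mem_filter => /andP[Qj jl] ->; have [] := hf j jl Qj.
rewrite -fsbig_seq// /m big_map big_filter -sumEFin.
rewrite [leLHS]big_seq_cond [leRHS]big_seq_cond.
by apply: lee_sum => j /andP[jl Qj]; have [] := hf j jl Qj.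
Qed.

Lemma esum_le_sum (K : choiceType) (S : set K) (f : K -> R) (g : K -> \bar R) :
  finite_set S -> (forall k, S k -> (0 <= g k <= (f k)%:E)%E) ->
  (\esum_(k in S) g k <= (\sum_(k <- fset_set S) f k)%:E)%E.
Proof.
move=> fS gf; rewrite esum_fset//; last first.
  by move=> k; rewrite inE => /gf/andP[].
rewrite fsbig_finite// -sumEFin [leLHS]big_seq_cond [leRHS]big_seq_cond.
apply: lee_sum => k; rewrite andbT in_fset_set// inE => /gf/andP[_ //].
Qed.

End sums.

Section finite_volume.
Context {R : realType} {d L : nat}.
Local Notation V := 'rV[int]_d.+1.
Local Notation E := (edges L : set (set V)).
Local Notation conf := (config E).
Implicit Types (w : conf) (x y z a b : V) (S D U A B C : set V) (e : E).
Implicit Types (F G : conf -> Prop) (p q : R).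

Definition eds D : seq E := fset_set [set e : E | val e `<=` D].

Lemma edge_code : exists f : E -> V * V, forall e, val e = [set (f e).1; (f e).2].
Proof.
have [f fP] : {f : E -> V * V & forall e, val e = [set (f e).1; (f e).2]}.
  apply: (@choice _ _ (fun e xy => val e = [set xy.1; xy.2])) => e.
  by have [x [y [_ _ ->]]] := set_valP e; exists (x, y).
by exists f.
Qed.

Lemma finite_eds D : finite_set D -> finite_set [set e : E | val e `<=` D].
Proof.
move=> fD; have [f fE] := edge_code.
apply: (@sub_finite_set _ _ (f @^-1` (D `*` D))).
  by move=> e /= eD; split; apply: eD; rewrite fE; [left|right].
apply: finite_preimage; last exact: finite_setX.
by move=> e e' _ _ ff; apply: val_inj; rewrite !fE ff.
Qed.

Lemma mem_eds D e : finite_set D -> (e \in eds D) = `[< val e `<=` D >].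
Proof. by move=> fD; rewrite in_fset_set; [apply/idP/asboolP; rewrite inE|exact: finite_eds]. Qed.

Lemma uniq_eds D : uniq (eds D). Proof. exact: fset_uniq. Qed.

Definition local_in D F := forall w w' : conf,
  (forall e, val e `<=` D -> w e = w' e) -> F w -> F w'.

Definition pr p F : R := fine (percolation d.+1 L p [set w | F w]).

Lemma local_determined D F : finite_set D -> local_in D F -> determined_by (eds D) F.
Proof.
by move=> fD FD w w' ww'; apply: FD => e eD; apply: ww'; rewrite mem_eds//; exact/asboolP.
Qed.

Section fixed_parameter.
Variable p : R.
Hypothesis p01 : 0 <= p <= 1.

Lemma local_measurable D F : finite_set D -> local_in D F ->
  measurable [set w | F w].
Proof.
move=> fD FD; have [//] := bernoulli_product_determined
  (percolationP p01) (uniq_eds D) (local_determined fD FD).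
Qed.

Lemma percolation_pr F : measurable [set w | F w] ->
  percolation d.+1 L p [set w | F w] = (pr p F)%:E.
Proof. by move=> mF; rewrite /pr fineK// fin_num_measure. Qed.

Lemma pr_Ex D F : finite_set D -> local_in D F ->
  pr p F = Ex p (eds D) (fun w => ind (F w)).
Proof.
move=> fD FD; have [_] := bernoulli_product_determined
  (percolationP p01) (uniq_eds D) (local_determined fD FD).
by rewrite /pr => ->.
Qed.

Lemma le_pr F G : measurable [set w | F w] -> measurable [set w | G w] ->
  (forall w, F w -> G w) -> pr p F <= pr p G.
Proof.
move=> mF mG FG; rewrite -lee_fin -!percolation_pr//.
by apply: le_measure; rewrite ?inE.
Qed.

Lemma pr_ge0 F : 0 <= pr p F.
Proof. by rewrite /pr fine_ge0. Qed.

Lemma pr_le1 F : measurable [set w | F w] -> pr p F <= 1.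
Proof. by move=> mF; rewrite -lee_fin -percolation_pr// probability_le1. Qed.

Lemma pr_second_moment C (J : eqType) (l : seq J) (A : J -> conf -> Prop) (lam : R) :
  finite_set C -> (forall j, local_in C (A j)) -> 0 < lam ->
  \sum_(j <- l) pr p (A j) <=
  lam * pr p (fun w => exists2 j, j \in l & A j w) +
  lam^-1 * \sum_(i <- l) \sum_(j <- l) pr p (fun w => A i w /\ A j w).
Proof.
move=> fC AC lam0; have := second_moment_truncation (eds C) l A p01 lam0.
under eq_bigr do rewrite -(pr_Ex fC)//.
rewrite -(pr_Ex fC); last first.
  by move=> w w' ww' [j jl Aj]; exists j => //; exact: AC Aj.
move=> /le_trans; apply; rewrite lerD2l ler_pM2l ?invr_gt0//.
apply: ler_sum => i _; apply: ler_sum => j _; rewrite (pr_Ex fC)//.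
by move=> w w' ww' [Ai Aj]; split; [exact: AC Ai|exact: AC Aj].
Qed.

(** A union bound over the possible cuts [j], then [BK3] for each of them; the restrictions of [w]
    to edge-disjoint vertex sets are the three witnesses. *)
Lemma BK_cover C (J : eqType) (l : seq J) F (A1 A2 A3 : J -> conf -> Prop) :
  finite_set C -> local_in C F ->
  (forall j, [/\ local_in C (A1 j), local_in C (A2 j) & local_in C (A3 j)]) ->
  (forall j, [/\ increasing_event (A1 j), increasing_event (A2 j) &
                increasing_event (A3 j)]) ->
  (forall w, F w -> exists2 j, j \in l & exists U1 U2 U3,
    [/\ edge_disjoint U1 U2, edge_disjoint U1 U3 & edge_disjoint U2 U3] /\
    [/\ A1 j (restr U1 w), A2 j (restr U2 w) & A3 j (restr U3 w)]) ->
  pr p F <= \sum_(j <- l) pr p (A1 j) * pr p (A2 j) * pr p (A3 j).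
Proof.
move=> fC FC AC Ai FA.
pose B j (w : E -> bool) := exists a b c : E -> bool,
    [/\ forall e, a e -> w e, forall e, b e -> w e & forall e, c e -> w e] /\
    [/\ forall e, a e -> b e -> False, forall e, a e -> c e -> False &
        forall e, b e -> c e -> False] /\ [/\ A1 j a, A2 j b & A3 j c].
apply: (@le_trans _ _ (\sum_(j <- l) Ex p (eds C) (fun w => ind (B j w)))); last first.
  apply: ler_sum => j _; have [? ? ?] := AC j; have [? ? ?] := Ai j.
  by rewrite !(pr_Ex fC)//; exact: BK3.
rewrite (pr_Ex fC)// -Ex_sum; apply: le_Ex => // w.
have [Fw|nFw] := pselect (F w); last first.
  by rewrite ind_false// sumr_ge0// => j _; exact: ind_ge0.
have [j jl [U1 [U2 [U3 [[U12 U13 U23] [H1 H2 H3]]]]]] := FA w Fw.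
rewrite (perm_big _ (perm_to_rem jl)) big_cons ind_true// (@ind_true _ (B j w)).
  by rewrite lerDl sumr_ge0// => i _; exact: ind_ge0.
exists (restr U1 w), (restr U2 w), (restr U3 w); split; [|split] => //; split => e.
- exact: restr_le.
- exact: restr_le.
- exact: restr_le.
- exact: restr_disjoint.
- exact: restr_disjoint.
- exact: restr_disjoint.
Qed.

End fixed_parameter.

Lemma pr_increasing p q C F : 0 <= p -> p <= q -> q <= 1 -> finite_set C ->
  local_in C F -> increasing_event F -> pr p F <= pr q F.
Proof.
move=> p0 pq q1 fC FC Fi.
have p01 : 0 <= p <= 1 by rewrite p0 (le_trans pq).
have q01 : 0 <= q <= 1 by rewrite q1 (le_trans p0).
rewrite (pr_Ex p01 fC FC) (pr_Ex q01 fC FC).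
by apply: Ex_increasing => // w w' ww'; apply: ind_le; exact: Fi.
Qed.

Lemma connected_in_local D C A B : D `<=` C ->
  local_in C (fun w => connected_in w D A B).
Proof.
move=> DC w w' ww' [a [s [Aa Bs Ds ps]]]; exists a, s; split => //.
by apply: open_path_sub ps => e es; rewrite ww'// => z /es /= zs; exact/DC/Ds.
Qed.

Lemma connected_in_increasing D A B :
  increasing_event (fun w => connected_in w D A B).
Proof. by move=> w w' ww'; exact: connected_in_mono. Qed.

Lemma connected_in_ind w D a (P : V -> Prop) : P a ->
  (forall x y, connected_in w D [set a] [set x] -> P x -> D y ->
     open_edge w x y -> P y) ->
  forall z, connected_in w D [set a] [set z] -> P z.
Proof.
move=> Pa PS z [_ [s [-> lz Ds ps]]]; move: lz => /= <-.
suff H t x : (forall z, z \in x :: t -> D z) -> open_path w x t -> P x ->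
    connected_in w D [set a] [set x] -> P (last x t).
  by apply: H => //; apply: connected_in_refl; apply: Ds; exact: mem_head.
elim: t x => [//|y t ih] x Dt /= /andP[/asboolP oxy pt] Px cx.
have Dy : D y by apply: Dt; rewrite !inE eqxx orbT.
apply: ih => //; first by move=> u ut; apply: Dt; rewrite inE ut orbT.
  exact: PS Px Dy oxy.
exact: connected_in_step cx Dy oxy.
Qed.

(** There are countably many finite sequences of vertices, and the openness of each depends on
    finitely many edges. *)
Lemma measurable_connected_in S A B :
  measurable [set w : conf | connected_in w S A B].
Proof.
rewrite [X in measurable X](_ : _ = \bigcup_(t : V * seq V) [set w : conf |
  [/\ A t.1, B (last t.1 t.2), (forall z, z \in t.1 :: t.2 -> S z) &
    open_path w t.1 t.2]]); last first.
  by apply/seteqP; split => [w [x [s H]]|w [[x s] _ H]]; [exists (x, s)|exists x, s].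
apply: countable_bigcupT_measurable; first exact: countableP.
move=> [x s] /=.
have [H|H] := pselect [/\ A x, B (last x s) & forall z, z \in x :: s -> S z]; last first.
  rewrite [X in measurable X](_ : _ = set0)//.
  by rewrite -subset0 => w [Ax Bs Ss _]; apply: H.
rewrite [X in measurable X](_ : _ = [set w : conf | open_path w x s]); last first.
  by apply/seteqP; split => w; [case|move=> ?; split=> //; case: H].
elim: s x {H} => [|y s ih] x.
  by rewrite [X in measurable X](_ : _ = setT)//; apply/seteqP; split.
rewrite [X in measurable X](_ : _ = [set w : conf | open_edge w x y] `&`
    [set w | open_path w y s]); last first.
  apply/seteqP; split => w; rewrite /open_path /=; first by move=> /andP[/asboolP].
  by move=> [? ?]; apply/andP; split => //; exact/asboolP.
apply: measurableI => //.
have [[e eE]|nE] := pselect (exists e : E, val e = [set x; y]); last first.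
  rewrite [X in measurable X](_ : _ = set0)//.
  by rewrite -subset0 => w [e eE _]; apply: nE; exists e.
rewrite [X in measurable X](_ : _ = [set w : conf | w e]).
  by apply: sub_sigma_algebra; exists e.
apply/seteqP; split => w; last by move=> we; exists e.
by move=> [e' e'E we']; rewrite (_ : e = e')//; apply: val_inj; rewrite eE e'E.
Qed.

Lemma pr_open_edge p x y : 0 <= p <= 1 -> pr p (fun w => open_edge w x y) <= p.
Proof.
move=> p01; have /andP[p0 p1] := p01.
have [[e eE]|nE] := pselect (exists e : E, val e = [set x; y]); last first.
  rewrite /pr (_ : [set w | _] = set0) ?measure0//.
  by rewrite -subset0 => w [e eE _]; apply: nE; exists e.
have det : determined_by [:: e] (fun w => open_edge w x y).
  move=> w w' ww' [e' e'E we']; exists e' => //.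
  have -> : e' = e by apply: val_inj; rewrite eE e'E.
  rewrite -ww' ?mem_head// (_ : e = e')//; apply: val_inj; by rewrite eE e'E.
have ue : uniq [:: e] by [].
have [_] := bernoulli_product_determined (percolationP p01) ue det.
rewrite /pr => ->; rewrite /= (@ind_false _ (open_edge (upd _ e false) _ _)); last first.
  move=> [e' e'E]; have -> : e' = e by apply: val_inj; rewrite eE e'E.
  by rewrite /upd eqxx.
by rewrite mulr0 addr0 ler_piMr// ind_le1.
Qed.

Definition cprob p D A B : R := pr p (fun w => connected_in w D A B).
Definition ctau p D x y : R := cprob p D [set x] [set y].

Lemma open_edge_local C x y : C x -> C y -> local_in C (fun w => open_edge w x y).
Proof.
by move=> Cx Cy w w' ww' [e eE we]; exists e => //; rewrite -ww'// eE => z [->|->].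
Qed.

Lemma open_edge_increasing x y : increasing_event (fun w => open_edge w x y).
Proof. by move=> w w' ww' [e eE we]; exists e => //; exact: ww'. Qed.

Definition exits S D : set (V * V) := [set xy | [/\ S xy.1, D xy.1, D xy.2, ~ S xy.2 &
  Defs.adjacent L xy.1 xy.2]].

Lemma finite_exits S D : finite_set D -> finite_set (exits S D).
Proof.
move=> fD; apply: (@sub_finite_set _ _ (D `*` D)); last exact: finite_setX.
by move=> [x y] [].
Qed.

Section bounds.
Variable p : R.
Hypothesis p01 : 0 <= p <= 1.

Lemma cprob_ge0 D A B : 0 <= cprob p D A B.
Proof. exact: pr_ge0. Qed.

Lemma cprob_le1 D A B : cprob p D A B <= 1.
Proof. by apply: pr_le1 => //; exact: measurable_connected_in. Qed.

Lemma le_cprob D A B D' A' B' : D `<=` D' -> A `<=` A' -> B `<=` B' ->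
  cprob p D A B <= cprob p D' A' B'.
Proof.
move=> DD AA BB; apply: le_pr => //; [exact: measurable_connected_in..|].
by move=> w; exact: connected_in_sub.
Qed.

Lemma ctau_sym D x y : ctau p D x y = ctau p D y x.
Proof.
by apply/eqP; rewrite eq_le; apply/andP; split; apply: le_pr => //;
  try exact: measurable_connected_in; move=> w; exact: connected_in_sym.
Qed.

Lemma ctau_tau D S x y : D `<=` S -> ((ctau p D x y)%:E <= tau L p S x y)%E.
Proof.
move=> DS; rewrite /tau /connection_probability percolation_pr ?lee_fin//; last first.
  exact: measurable_connected_in.
exact: le_cprob.
Qed.

Lemma simon_lieb S D a B : finite_set D -> S a -> (forall b, B b -> ~ S b) ->
  cprob p D [set a] B <= \sum_(xy <- fset_set (exits S D))
    ctau p (S `&` D) a xy.1 * p * cprob p D [set xy.2] B.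
Proof.
move=> fD Sa BS; have /andP[p0 p1] := p01.
(* Membership in [D] is put into the middle event so that it is local to [D] for every index, as
   [BK_cover] requires. *)
apply: le_trans (@BK_cover _ p01 D _ (fset_set (exits S D)) _
  (fun xy w => connected_in w (S `&` D) [set a] [set xy.1])
  (fun xy w => [/\ D xy.1, D xy.2 & open_edge w xy.1 xy.2])
  (fun xy w => connected_in w D [set xy.2] B) fD _ _ _ _) _.
- exact: connected_in_local.
- move=> [x y]; split; try exact: connected_in_local; last first.
    by move=> w w' ww' [/= Dx Dy oxy]; split => //; apply: open_edge_local ww' oxy.
- move=> [x y]; split; try exact: connected_in_increasing.
  by move=> w w' ww' [Dx Dy oxy]; split => //; exact: open_edge_increasing oxy.
- move=> w /(exit_witness Sa BS)[x [y [[Sx Dx Dy Sy xy]]]].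
  move=> [U1 [U2 [U3 [Us [H1 H2 H3]]]]]; exists (x, y); last by exists U1, U2, U3.
  by rewrite in_fset_set ?inE//; exact: finite_exits.
rewrite [leLHS]big_seq_cond [leRHS]big_seq_cond; apply: ler_sum => -[x y].
rewrite andbT in_fset_set; last exact: finite_exits.
rewrite inE => -[/= _ Dx Dy _ _].
rewrite ler_wpM2r ?cprob_ge0// ler_wpM2l ?cprob_ge0//.
apply: le_trans (pr_open_edge x y p01); apply: le_pr => //.
- by apply: (@local_measurable _ p01 D) => // w w' ww' [_ _ oxy]; split => //;
    apply: open_edge_local ww' oxy.
- apply: (@local_measurable _ p01 [set x; y]) => //.
  by apply: open_edge_local; [left|right].
- by move=> w [].
Qed.

Lemma tree_graph D a x y : finite_set D ->
  pr p (fun w => connected_in w D [set a] [set x] /\ connected_in w D [set a] [set y]) <=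
  \sum_(z <- fset_set D) ctau p D a z * ctau p D z x * ctau p D z y.
Proof.
move=> fD; apply: (@BK_cover _ p01 D _ (fset_set D)) => //.
- have DD := @subset_refl _ D.
  by move=> w w' ww' [H1 H2]; split; [exact: (connected_in_local DD ww' H1)|
    exact: (connected_in_local DD ww' H2)].
- by move=> z; split; exact: connected_in_local.
- by move=> z; split; exact: connected_in_increasing.
- by move=> w [H1 H2]; have [z Dz H] := tree_witness H1 H2; exists z => //;
    rewrite in_fset_set ?inE.
Qed.

Lemma lowest_point_bound (h : V -> int) D a b : finite_set D ->
  ctau p D a b <= \sum_(z <- fset_set (D `&` [set z | h z <= h a]))
    ctau p (D `&` [set v | h z <= h v]) a z *
    ctau p (D `&` [set v | h z <= h v]) z b.
Proof.
move=> fD; have fDh : finite_set (D `&` [set z | h z <= h a]).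
  by apply: sub_finite_set fD => z [].
(* Only two pieces here: the third event is trivial, with the empty set as its witness. *)
apply: le_trans (@BK_cover _ p01 D _ (fset_set (D `&` [set z | h z <= h a])) _
  (fun z w => connected_in w (D `&` [set v | h z <= h v]) [set a] [set z])
  (fun z w => connected_in w (D `&` [set v | h z <= h v]) [set z] [set b])
  (fun _ _ => True) fD _ _ _ _) _.
- exact: connected_in_local.
- by move=> z; split => //; apply: connected_in_local => v [].
- by move=> z; split => //; exact: connected_in_increasing.
- move=> w /(lowest_witness h)[z [Dz hz] [U1 [U2 [U12 [H1 H2]]]]].
  exists z; first by rewrite in_fset_set ?inE.
  by exists U1, U2, set0; split; split => // u v _ [].
apply: ler_sum => z _; rewrite ler_piMr ?mulr_ge0 ?cprob_ge0//.
by apply: pr_le1 => //; exact: (@local_measurable _ p01 set0).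
Qed.

Lemma cprob_isometry (g : V -> V) D A B D' A' B' :
  (forall x y, `|g x - g y| = `|x - y|) -> finite_set D -> finite_set D' ->
  g @` D `<=` D' -> g @` A `<=` A' -> g @` B `<=` B' ->
  cprob p D A B <= cprob p D' A' B'.
Proof.
move=> giso fD fD' gD gA gB; have [h [hi hc]] := @isometry_edges _ L g giso.
rewrite /cprob (pr_Ex p01 fD (connected_in_local (@subset_refl _ D))).
rewrite -(Ex_map _ _ _ hi).
have det : determined_by (map h (eds D)) (fun w => connected_in (w \o h : conf) D A B).
  move=> w w' ww'; apply: (local_determined fD (connected_in_local (@subset_refl _ D))).
  by move=> e eD /=; apply: ww'; exact: map_f.
have us : uniq (map h (eds D)) by rewrite map_inj_uniq ?uniq_eds.
have [mF FE] := bernoulli_product_determined (percolationP p01) us det.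
rewrite -lee_fin -FE -percolation_pr//; last exact: measurable_connected_in.
apply: le_measure; rewrite ?inE//; first exact: measurable_connected_in.
by move=> w /hc; exact: connected_in_sub.
Qed.

End bounds.

Lemma le_cprob_p p q D A B : 0 <= p -> p <= q -> q <= 1 -> finite_set D ->
  cprob p D A B <= cprob q D A B.
Proof.
move=> p0 pq q1 fD; apply: (@pr_increasing _ _ D) => //.
- exact: connected_in_local.
- exact: connected_in_increasing.
Qed.

End finite_volume.

Section lattice.
Context {d L : nat}.
Local Notation V := 'rV[int]_d.+1.
Implicit Types (x y z : V) (S D : set V) (n : nat).

Lemma coordD x y i : (x + y) 0 i = x 0 i + y 0 i.
Proof. by rewrite mxE. Qed.

Lemma coordN x i : (- x) 0 i = - x 0 i.
Proof. by rewrite mxE. Qed.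

Lemma coordB x y i : (x - y) 0 i = x 0 i - y 0 i.
Proof. by rewrite !mxE. Qed.

Lemma norm_coordP x (c : int) : 0 <= c ->
  (`|x| <= c) <-> (forall i, `|x 0 i| <= c).
Proof.
move=> c0; rewrite -[ `|x| ]/(mx_norm x) mx_normrE; split.
  by move=> /bigmax_leP[_ H] i; exact: (H (0, i)).
by move=> H; apply/bigmax_leP; split => // -[i j] _ /=; rewrite ord1.
Qed.

Lemma adjacent_coord x y : Defs.adjacent L x y -> forall i,
  - L%:Z <= x 0 i - y 0 i <= L%:Z.
Proof.
move=> /adjacentP[_ /norm_coordP H] i.
by have := H (le0z_nat L) i; rewrite coordB ler_norml.
Qed.

Lemma finite_box n : finite_set (@box d.+1 n).
Proof.
pose F (f : {ffun 'I_d.+1 -> 'I_(n + n).+1}) : V := \row_i ((f i : nat)%:Z - n%:Z).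
apply: (@sub_finite_set _ _ (F @` setT)); last exact/finite_image/finite_finset.
move=> x bx; have Hx (i : 'I_d.+1) : (absz (x 0 i + n%:Z)%R < (n + n).+1)%N.
  by have := bx i; lia.
exists [ffun i => Ordinal (Hx i)] => //.
apply/rowP => i; rewrite !mxE ffunE /=.
by have := bx i; lia.
Qed.

Lemma finite_sub_box n D : D `<=` box n -> finite_set D.
Proof. by move=> Dn; apply: sub_finite_set (finite_box n). Qed.

Lemma box0 n : @box d.+1 n 0.
Proof. by move=> i; rewrite mxE; lia. Qed.

Lemma le_box n m : (n <= m)%N -> @box d.+1 n `<=` box m.
Proof. by move=> nm x xn i; have := xn i; lia. Qed.

Lemma box_adjacent n x y : box n x -> Defs.adjacent L x y -> box (n + L) y.
Proof.
by move=> xn /adjacent_coord xy i; have := xn i; have := xy i; lia.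
Qed.

Lemma boxPn n x : ~ box n x -> exists i, n%:Z < `|x 0 i|.
Proof.
move=> /existsNP[i H]; exists i; rewrite ltNge; apply/negP => H'.
by apply: H; lia.
Qed.

End lattice.

(** * Entropic comparison of connection probabilities *)

Section cluster_exploration.
Context {R : realType} {d L : nat}.
Local Notation V := 'rV[int]_d.+1.
Local Notation E := (edges L : set (set V)).
Local Notation conf := (config E).
Implicit Types (w : conf) (x y z a b : V) (S D B : set V) (e : E) (p q : R).

(** The edges revealed by exploring the cluster of [a] in [D], including the closed ones on its
    boundary. *)
Let touched D a (w : E -> bool) e :=
  `[< exists2 x, (val e) x & connected_in (w : conf) D [set a] [set x] >].

(** If two configurations agree on the revealed edges, the cluster grows identically in both: each
    step uses an edge touching what has already been reached. *)
Let touched_stopping D a B : D a ->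
  stopping (touched D a) (fun w => ind (connected_in (w : conf) D [set a] B) : R).
Proof.
move=> Da w w' ww'.
have C1 z : connected_in (w : conf) D [set a] [set z] ->
    connected_in (w' : conf) D [set a] [set z].
  apply: (@connected_in_ind _ _ w D a (fun z => connected_in (w' : conf) D [set a] [set z])).
    exact: connected_in_refl.
  move=> x y cx cx' Dy [e eE we]; apply: connected_in_step cx' Dy _.
  by exists e => //; rewrite -ww'//; apply/asboolP; exists x => //; rewrite eE; left.
have C2 z : connected_in (w' : conf) D [set a] [set z] ->
    connected_in (w : conf) D [set a] [set z].
  apply: (@connected_in_ind _ _ w' D a (fun z => connected_in (w : conf) D [set a] [set z])).
    exact: connected_in_refl.
  move=> x y _ cx Dy [e eE we']; apply: connected_in_step (cx) Dy _.
  by exists e => //; rewrite ww'//; apply/asboolP; exists x => //; rewrite eE; left.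
split.
  by move=> e; apply/asboolP/asboolP => -[x ex cx]; exists x => //; [exact: C2|exact: C1].
have CB (u v : conf) : (forall z, connected_in u D [set a] [set z] ->
    connected_in v D [set a] [set z]) ->
    connected_in u D [set a] B -> connected_in v D [set a] B.
  move=> uv /connected_in_end[_ [b [-> Bb _ _ /uv]]].
  by apply: connected_in_sub => // _ ->.
by rewrite /ind; congr (_%:R); congr nat_of_bool; apply/asboolP/asboolP; exact: CB.
Qed.

Let incident_edges D x : finite_set D ->
  \sum_(e <- eds D : seq E) ind ((val e) x) <= (#|` fset_set (@box d.+1 L)|)%:R :> R.
Proof.
move=> fD; have [f fE] := @edge_code d L.
have -> : \sum_(e <- eds D : seq E) ind ((val e) x) =
    \sum_(e <- (eds D : seq E) | `[< (val e) x >]) 1 :> R.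
  by rewrite [RHS]big_mkcond; apply: eq_bigr => e _; rewrite /ind; case: ifP.
rewrite -sum1_size natr_sum.
(* This is the other end of [e] relative to [x], written symmetrically because [f] lists the two
   ends in an arbitrary order. *)
apply: (ler_sum_inj (h := fun e => (f e).1 + (f e).2 - x - x)).
- exact: uniq_eds.
- move=> e e' _ _ /asboolP + /asboolP + /addIr/addIr; rewrite !fE.
  move=> ex e'x ff; apply: val_inj; rewrite !fE.
  case: ex e'x ff => -> [] ->.
  + by move=> /addrI ->.
  + by rewrite [RHS]addrC => /addrI ->; rewrite setUC.
  + by rewrite [LHS]addrC => /addrI <-; rewrite setUC.
  + by move=> /addIr ->.
- move=> e _ /asboolP; rewrite fE => ex; split => //.
  rewrite in_fset_set; last exact: finite_box.
  have : Defs.adjacent L (f e).1 (f e).2 by rewrite /Defs.adjacent -fE; exact: set_valP.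
  move=> /adjacent_coord fL; rewrite inE => i; have := fL i.
  by case: ex => ->; rewrite !(coordB, coordD); lia.
- by [].
Qed.

(** Each vertex of the cluster reveals at most as many edges as [box L] has points, so the expected
    number of queries is controlled by the expected cluster size. *)
Lemma entropic_cprob p q D a B : finite_set D -> D a -> 0 < q < 1 -> 0 < p < 1 ->
  (1 - expR (-1)) * cprob (L := L) p D [set a] B <= cprob (L := L) q D [set a] B +
  (p - q) ^+ 2 / (p * (1 - p)) * ((#|` fset_set (@box d.+1 L)|)%:R *
    \sum_(x <- fset_set D) ctau (L := L) q D a x).
Proof.
move=> fD Da q01 p01.
have p01' : 0 <= p <= 1 by case/andP: p01 => *; rewrite !ltW.
have q01' : 0 <= q <= 1 by case/andP: q01 => *; rewrite !ltW.
have DD := @subset_refl _ D.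
have := entropic_bound (uniq_eds D) q01 p01 (touched_stopping B Da).
rewrite /cprob (pr_Ex p01' fD (connected_in_local DD)).
rewrite (pr_Ex q01' fD (connected_in_local DD)) => /le_trans; apply.
rewrite lerD2l ler_wpM2l//.
  by case/andP: p01 => p0 p1; rewrite divr_ge0 ?sqr_ge0// mulr_ge0 ?subr_ge0// ltW.
apply: (@le_trans _ _ (\sum_(e <- eds D) \sum_(x <- fset_set D)
    ind ((val e) x) * ctau (L := L) q D a x)).
  apply: ler_sum => e _.
  under eq_bigr do rewrite /ctau /cprob (pr_Ex q01' fD (connected_in_local DD)) -ExZ.
  rewrite -Ex_sum; apply: le_Ex => // w; rewrite /touched.
  case: asboolP => [[x ex cx]|_]; last first.
    by apply: sumr_ge0 => x _; rewrite mulr_ge0 ?ind_ge0.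
  have [_ [b [_ + _ + _]]] := connected_in_end cx; move=> /= -> Dx.
  have xD : x \in fset_set D by rewrite in_fset_set ?inE.
  rewrite (perm_big _ (perm_to_rem xD)) big_cons !ind_true// mulr1 lerDl.
  by apply: sumr_ge0 => y _; rewrite mulr_ge0 ?ind_ge0.
rewrite exchange_big mulr_sumr /=; apply: ler_sum => x _.
by rewrite -mulr_suml ler_wpM2r ?cprob_ge0// incident_edges.
Qed.

End cluster_exploration.

(** * Fluxes through half-spaces and boxes *)

Lemma ler_sum_cover (R : realType) (J K : eqType) (l : seq J) (m : seq K)
    (c : K -> pred J) (f : J -> R) : (forall j, 0 <= f j) ->
  (forall j, j \in l -> exists2 k, k \in m & c k j) ->
  \sum_(j <- l) f j <= \sum_(k <- m) \sum_(j <- l | c k j) f j.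
Proof.
move=> f0 cover; under [leRHS]eq_bigr do rewrite big_mkcond.
rewrite exchange_big /= [leLHS]big_seq [leRHS]big_seq; apply: ler_sum => j jl.
have [k km ckj] := cover j jl.
rewrite (perm_big _ (perm_to_rem km)) big_cons ckj lerDl.
by apply: sumr_ge0 => i _; case: ifP.
Qed.

Section half_spaces.
Context {d : nat}.
Local Notation V := 'rV[int]_d.+1.
Implicit Types (x y z w : V) (n k : nat).

Lemma half_spaceP x : half_space x <-> 0 <= x 0 0.
Proof.
split=> [|x0 i i0]; first by apply.
by rewrite (_ : i = 0)//; exact: val_inj.
Qed.

Lemma coord_e1 : (e1 d.+1) 0 0 = 1.
Proof. by rewrite mxE. Qed.

Lemma shifted_half_spaceP n x : shifted_half_space n%:Z x <-> - n%:Z <= x 0 0.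
Proof.
have E : (n%:Z *: e1 d.+1 : V) 0 0 = n%:Z by rewrite mxE coord_e1 mulr1.
split=> [[y /half_spaceP y0 <-]|x0]; first by rewrite coordB E; lia.
exists (x + n%:Z *: e1 d.+1); last by rewrite addrK.
by apply/half_spaceP; rewrite coordD E; lia.
Qed.

Lemma le_norm_coord x y : (forall i, exists j, `|x 0 i| = `|y 0 j|) -> `|x| <= `|y|.
Proof.
move=> H; have y0 : 0 <= `|y| by [].
apply/norm_coordP => // i; have [j ->] := H i.
by have /norm_coordP := lexx `|y|; apply.
Qed.

(* Isometries sending [w] to the origin and the direction [e_i], or [-e_i] when
   [b] is true, to [e_1]. *)
Definition flip (b : bool) (i : 'I_d.+1) w z : V :=
  \row_k (if b then w 0 (tperm 0 i k) - z 0 (tperm 0 i k)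
               else z 0 (tperm 0 i k) - w 0 (tperm 0 i k)).

Lemma flipE b i w z (k : 'I_d.+1) : flip b i w z 0 k =
  if b then w 0 (tperm 0 i k) - z 0 (tperm 0 i k)
       else z 0 (tperm 0 i k) - w 0 (tperm 0 i k).
Proof. by rewrite mxE. Qed.

Lemma flip_isometry b i w x y : `|flip b i w x - flip b i w y| = `|x - y|.
Proof.
have E (k : 'I_d.+1) : `|(flip b i w x - flip b i w y) 0 k| = `|(x - y) 0 (tperm 0 i k)|.
  by rewrite !coordB !flipE; case: (b); lia.
apply/eqP; rewrite eq_le; apply/andP; split; apply: le_norm_coord => k.
  by exists (tperm 0 i k).
by exists (tperm 0 i k); rewrite E tpermK.
Qed.

Lemma flip_id b i w : flip b i w w = 0.
Proof. by apply/rowP => k; rewrite !mxE; case: b; rewrite subrr. Qed.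

Lemma translation_isometry w x y : `|(x - w) - (y - w)| = `|x - y|.
Proof. by rewrite opprB addrA subrK. Qed.

Lemma box_face n x : ~ box n x -> exists (bi : bool * 'I_d.+1),
  n%:Z < (if bi.1 then - x 0 bi.2 else x 0 bi.2).
Proof.
move=> /boxPn[i ni]; exists (x 0 i < 0, i) => /=.
by case: (ltP (x 0 i) 0) => x0; lia.
Qed.

Lemma box_flux_faces (R : realType) (f : V * V -> R) (l : seq (V * V)) n (b : R) :
  (forall xy, 0 <= f xy) -> (forall xy, xy \in l -> ~ box n xy.2) ->
  (forall (bi : bool * 'I_d.+1), \sum_(xy <- l |
     n%:Z < (if bi.1 then - xy.2 0 bi.2 else xy.2 0 bi.2)) f xy <= b) ->
  \sum_(xy <- l) f xy <= (d.+1 * 2)%:R * b.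
Proof.
move=> f0 ln fb.
pose c (bi : bool * 'I_d.+1) (xy : V * V) :=
  n%:Z < (if bi.1 then - xy.2 0 bi.2 else xy.2 0 bi.2).
have cover xy : xy \in l -> exists2 bi, bi \in enum {: bool * 'I_d.+1} & c bi xy.
  by move=> /ln/box_face[bi ?]; exists bi; rewrite ?mem_enum.
apply: le_trans (ler_sum_cover f0 cover) _.
apply: (@le_trans _ _ (\sum_(bi <- enum {: bool * 'I_d.+1}) b)).
  by apply: ler_sum => bi _; exact: fb.
by rewrite big_enum sumr_const card_prod card_bool card_ord mulnC mulr_natl.
Qed.

End half_spaces.

Section estimates.
Context {R : realType} {d L : nat}.
Local Notation V := 'rV[int]_d.+1.
Implicit Types (x y z a b w : V) (S D A B : set V) (n m k : nat).
Variable p : R.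
Hypothesis p01 : 0 < p <= 1.
Local Notation H := (@half_space d.+1).
Local Notation ctau := (@ctau R d L p).
Local Notation cprob := (@cprob R d L p).
Local Notation exits := (@exits d L).

Let p01' : 0 <= p <= 1. Proof. by case/andP: p01 => /ltW ->. Qed.
Let p_gt0 : 0 < p. Proof. by case/andP: p01. Qed.
Let p_le1 : p <= 1. Proof. by case/andP: p01. Qed.

Definition box_flux n w : R :=
  \sum_(xy <- fset_set (exits (box n) (box (n + L)))) ctau (box n) w xy.1.

(** The mean number of exits: an exit counts as soon as its inner end is reached inside the
    half-box, whatever the state of the crossing edge. *)
Definition half_flux n : R :=
  \sum_(xy <- fset_set (exits (box n) (H `&` box (n + L)))) ctau (H `&` box n) 0 xy.1.

(** Edges have range at most [L], so the first vertex outside [box n] lies in [box (n + L)]: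
    confining the path there does not change the full-space arm event. *)
Definition arm n : R := cprob (box (n + L)) [set 0] (~` box n).

Definition half_arm n : R := cprob (H `&` box (n + L)) [set 0] (~` box n).

Lemma finite_half_box n : finite_set (H `&` box n).
Proof. by apply: (finite_sub_box (n := n)) => z []. Qed.

Lemma finite_box_exits n : finite_set (exits (box n) (box (n + L))).
Proof. by apply: finite_exits; exact: finite_box. Qed.

Lemma finite_half_exits n : finite_set (exits (box n) (H `&` box (n + L))).
Proof. by apply: finite_exits; exact: finite_half_box. Qed.

Lemma half_flux_ge0 n : 0 <= half_flux n.
Proof. by apply: sumr_ge0 => xy _; exact: cprob_ge0. Qed.

Lemma arm_ge0 n : 0 <= arm n. Proof. exact: cprob_ge0. Qed.

Lemma half_arm_ge0 n : 0 <= half_arm n. Proof. exact: cprob_ge0. Qed.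

Lemma adjacent_box_out n x y : (L <= n)%N -> ~ box n y -> Defs.adjacent L x y ->
  ~ box (n - L) x.
Proof.
move=> Ln yn xy xn; apply: yn.
by have := box_adjacent xn xy; rewrite subnK.
Qed.

Lemma le_phi_sum (J : eqType) (l : seq J) (S : set V) (Q : pred J)
    (h : J -> V * V) (f : J -> R) : uniq l ->
  (forall i j, i \in l -> j \in l -> Q i -> Q j -> h i = h j -> i = j) ->
  (forall j, j \in l -> Q j -> [/\ S (h j).1, ~ S (h j).2,
     Defs.adjacent L (h j).1 (h j).2 & ((f j)%:E <= tau L p S 0 (h j).1)%E]) ->
  ((p * \sum_(j <- l | Q j) f j)%:E <= phi L p S)%E.
Proof.
move=> ul hi hf; rewrite EFinM; apply: lee_wpmul2l; first by rewrite lee_fin ltW.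
apply: (sum_le_esum (h := h)) => // j jl Qj.
by have [] := hf j jl Qj.
Qed.

(* A vertex of the bottom layer of a half-space has a neighbour outside it. *)
Lemma level_flux k (l : seq V) (Q : pred V) (h : V -> V) (f : V -> R) (b : R) :
  (0 < L)%N ->
  (phi L p (shifted_half_space k%:Z : set V) <= b%:E)%E ->
  uniq l -> injective h ->
  (forall x, x \in l -> Q x -> (h x) 0 0 = - k%:Z /\
     ((f x)%:E <= tau L p (shifted_half_space k%:Z : set V) 0 (h x))%E) ->
  \sum_(x <- l | Q x) f x <= b / p.
Proof.
move=> L0 phib ul hi hf; rewrite ler_pdivlMr// mulrC -lee_fin.
apply: le_trans phib; apply: (le_phi_sum (h := fun x => (h x, h x - e1 d.+1))) => //.
  by move=> x y _ _ _ _ [/hi].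
move=> x xl Qx; have [hx fx] := hf x xl Qx; split => //=.
- by apply/shifted_half_spaceP; rewrite hx.
- by move=> /shifted_half_spaceP; rewrite coordB hx coord_e1; lia.
- apply/adjacentP; split.
    move=> E; have : (h x) 0 0 = (h x - e1 d.+1) 0 0 by rewrite -E.
    by rewrite coordB coord_e1; lia.
  apply/norm_coordP => // i; rewrite opprB addrC subrK mxE.
  by case: (i == 0 :> nat) => /=; lia.
Qed.

(* Seen from a vertex at height [k], the origin lies on the bottom layer of the
   half-space of depth [k]. *)
Lemma half_susceptibility (b s : R) D : (0 < L)%N -> 0 <= b -> 0 < s ->
  (forall k, (phi L p (shifted_half_space k%:Z : set V) <=
     (b * expR (- s * k%:R))%:E)%E) ->
  finite_set D -> D `<=` H ->
  \sum_(x <- fset_set D) ctau D 0 x <= b / p * (1 + s^-1).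
Proof.
move=> L0 b0 s0 phib fD DH; pose N := \max_(x <- fset_set D) absz (x 0 0)%R.
apply: (@le_trans _ _ (\sum_(k <- iota 0 N.+1)
    \sum_(x <- fset_set D | x 0 0 == k%:Z) ctau D 0 x)).
  apply: ler_sum_cover; first by move=> x; exact: cprob_ge0.
  move=> x xD; exists (absz (x 0 0)%R).
    rewrite mem_iota add0n ltnS /=.
    exact: (@leq_bigmax_seq _ (fset_set D : seq V) xpredT (fun x : V => absz (x 0 0)%R)).
  have : D x by move: xD; rewrite in_fset_set ?inE.
  by move=> /DH/half_spaceP x0; rewrite gez0_abs.
have r0 : 0 < 1 - expR (- s) by rewrite subr_gt0 expR_lt1 oppr_lt0.
apply: (@le_trans _ _ (\sum_(k <- iota 0 N.+1) (b / p) * expR (- s) ^+ k)).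
  apply: ler_sum => k _; rewrite -expRM_natr mulrAC.
  apply: (level_flux (k := k) (h := fun x => - x)) => //.
  - exact: fset_uniq.
  - move=> x; rewrite in_fset_set// inE => Dx /eqP xk; rewrite coordN xk; split => //.
    rewrite ctau_sym//.
    apply: (@le_trans _ _ (ctau ([set z - x | z in D]) 0 (- x))%:E).
      rewrite lee_fin; apply: (cprob_isometry p01' (g := fun z => z - x)) => //.
      + exact: translation_isometry.
      + exact: finite_image.
      + by move=> _ [_ -> <-]; rewrite /= subrr.
      + by move=> _ [_ -> <-]; rewrite /= sub0r.
    apply: ctau_tau => // _ [z Dz <-]; apply/shifted_half_spaceP.
    by rewrite coordB xk; have /half_spaceP := DH z Dz; lia.
rewrite -mulr_sumr ler_wpM2l ?divr_ge0 ?(ltW p_gt0)//.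
have -> : \sum_(k <- iota 0 N.+1) expR (- s) ^+ k = \sum_(k < N.+1) expR (- s) ^+ k.
  by rewrite -[iota 0 N.+1]/(index_iota 0 N.+1) big_mkord.
have := subrX1 (expR (- s)) N.+1; set T := \sum_(k < _) _ => ET.
have ET' : (1 - expR (- s)) * T = 1 - expR (- s) ^+ N.+1.
  by rewrite -[RHS]opprB ET -mulNr opprB.
rewrite -(ler_pM2l r0) ET'; apply: (@le_trans _ _ 1).
  by rewrite gerBl exprn_ge0// expR_ge0.
have e0 : 0 < expR (- s) by exact: expR_gt0.
(* The geometric series is at most $1/(1-e^{-s})\le 1+1/s$, because $e^s\ge 1+s$. *)
have : 1 + s <= (expR (- s))^-1 by rewrite expRN invrK expR_ge1Dx.
rewrite -[X in X <= _]invrK lef_pV2 ?posrE ?invr_gt0 ?addr_gt0//.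
move=> es; have : 1 - (1 + s)^-1 <= 1 - expR (- s) by rewrite lerD2l lerN2.
have -> : 1 - (1 + s)^-1 = (1 + s^-1)^-1.
  by field; rewrite !gt_eqF//= ?addr_gt0.
move=> h; have s1 : 0 < 1 + s^-1 by rewrite addr_gt0 ?invr_gt0.
by rewrite -ler_pdivrMr// mul1r.
Qed.

(** Exits through one face leave the half-space bounded by that face. An isometry taking [w] to the
    origin turns it into [shifted_half_space k], where [k] is the distance from [w] to the face. *)
Lemma le_box_flux (b : R) n w : box n w ->
  (forall k, (phi L p (shifted_half_space k%:Z : set V) <= b%:E)%E) ->
  box_flux n w <= (d.+1 * 2)%:R * (b / p).
Proof.
move=> wn phib; apply: (box_flux_faces (n := n)).
- by move=> xy; exact: cprob_ge0.
- by move=> xy; rewrite in_fset_set ?inE; [case|exact: finite_box_exits].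
move=> [c i] /=; rewrite ler_pdivlMr// mulrC -lee_fin.
pose k := absz (n%:Z + (if c then w 0 i else - w 0 i)).
have kE : k%:Z = n%:Z + (if c then w 0 i else - w 0 i).
  by rewrite /k; have := wn i; case: (c); lia.
apply: le_trans (phib k); pose g := flip (~~ c) i w.
have g0 z : (g z) 0 0 = if c then z 0 i - w 0 i else w 0 i - z 0 i.
  by rewrite flipE tpermL; case: (c).
apply: (le_phi_sum (h := fun xy => (g xy.1, g xy.2))).
- exact: fset_uniq.
- move=> [x y] [x' y'] _ _ _ _ /= [].
  have gi : injective g by apply: isometry_inj; exact: flip_isometry.
  by move=> /gi -> /gi ->.
- move=> [x y]; rewrite in_fset_set; last exact: finite_box_exits.
  rewrite inE /= => -[/= xn _ _ yn xy] yi; split => //.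
  + by apply/shifted_half_spaceP; rewrite g0 kE; have := xn i; case: (c); lia.
  + by move=> /shifted_half_spaceP; rewrite g0 kE; move: yi; case: (c); lia.
  + move/adjacentP: xy => [nxy xyL]; apply/adjacentP; split.
      by move/(isometry_inj (flip_isometry _ _ _)).
    by rewrite flip_isometry.
  + apply: (@le_trans _ _ (ctau (g @` box n) 0 (g x))%:E).
      rewrite lee_fin; apply: (cprob_isometry p01' (g := g)) => //.
      * exact: flip_isometry.
      * exact: finite_box.
      * by apply: finite_image; exact: finite_box.
      * by move=> _ [_ -> <-]; exact: flip_id.
      * by move=> _ [_ -> <-].
    apply: ctau_tau => // _ [z zn <-]; apply/shifted_half_spaceP.
    by rewrite g0 kE; have := zn i; case: (c); lia.
Qed.

Lemma translated_arm D n k y : finite_set D -> box k y -> (k <= n)%N ->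
  cprob D [set y] (~` box n) <= arm (n - k).
Proof.
move=> fD yk kn.
apply: le_trans (cprob_isometry p01' (g := fun z => z - y) _ fD
  (finite_image _ fD) (@subset_refl _ _) (@subset_refl _ _) (@subset_refl _ _)) _.
  exact: translation_isometry.
apply: le_pr => //; [exact: measurable_connected_in..|] => w.
have yB b : [set z - y | z in ~` box n] b -> ~ box (n - k) b.
  by move=> [z zn <-] zk; apply: zn => i; have := zk i; have := yk i;
    rewrite coordB; lia.
have yA : [set z - y | z in [set y]] `<=` box (n - k).
  by move=> _ [_ -> <-]; rewrite subrr; exact: box0.
move=> /(connected_in_truncate yA yB); apply: connected_in_sub => //.
  move=> z [_ [zn|[x xn xz]]]; last exact: box_adjacent xn xz.
  exact: le_box (leq_addr _ _) _ zn.
by move=> _ [_ -> <-]; rewrite /= subrr.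
Qed.

(** Cut at the first exit from [box k]: the factor [p] of the crossing edge completes [phi], and the
    rest is an arm seen from a vertex of [box (k + L)]. *)
Lemma arm_step (b : R) n k : (phi L p (@box d.+1 k) <= b%:E)%E -> (k + L <= n)%N ->
  arm n <= b * arm (n - (k + L)).
Proof.
move=> phib kn; have fD := @finite_box d (n + L).
apply: le_trans (simon_lieb p01' (S := box k) fD (@box0 d k) _) _.
  by move=> z zn zk; apply: zn; apply: le_box zk; lia.
apply: (@le_trans _ _ (\sum_(xy <- fset_set (exits (box k) (box (n + L))))
   (p * ctau (box k `&` box (n + L)) 0 xy.1) * arm (n - (k + L)))).
  rewrite [leLHS]big_seq [leRHS]big_seq; apply: ler_sum => -[x y].
  rewrite in_fset_set ?inE; last exact: finite_exits.
  move=> [/= xk _ _ _ xy]; rewrite [p * _]mulrC ler_wpM2l ?mulr_ge0 ?cprob_ge0//.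
    by rewrite ltW.
  by apply: translated_arm => //; exact: box_adjacent xk xy.
rewrite -mulr_suml ler_wpM2r ?arm_ge0// -mulr_sumr -lee_fin.
apply: le_trans phib; apply: (le_phi_sum (h := id)) => //; first exact: fset_uniq.
move=> [x y]; rewrite in_fset_set ?inE; last exact: finite_exits.
move=> [/= xk _ _ yk xy] _; split => //.
by apply: ctau_tau => // z [].
Qed.

(** The half-space constraint is kept up to the first exit from [box m] and dropped afterwards,
    which is why the second factor is a full-space arm. *)
Lemma half_arm_step n m : (m + L <= n)%N ->
  half_arm n <= half_flux m * arm (n - (m + L)).
Proof.
move=> mn; have fD := @finite_half_box (n + L).
apply: le_trans (simon_lieb p01' (S := box m) fD (@box0 d m) _) _.
  by move=> z zn zk; apply: zn; apply: le_box zk; lia.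
apply: (@le_trans _ _ (\sum_(xy <- fset_set (exits (box m) (H `&` box (n + L))))
   ctau (box m `&` (H `&` box (n + L))) 0 xy.1 * arm (n - (m + L)))).
  rewrite [leLHS]big_seq [leRHS]big_seq; apply: ler_sum => -[x y].
  rewrite in_fset_set ?inE; last exact: finite_exits.
  move=> [/= xm _ _ _ xy]; rewrite -mulrA ler_wpM2l ?cprob_ge0//.
  apply: (@le_trans _ _ (1 * arm (n - (m + L)))); last by rewrite mul1r.
  rewrite ler_pM ?cprob_ge0 ?(ltW p_gt0)//.
  by apply: translated_arm => //; exact: box_adjacent xm xy.
rewrite -mulr_suml ler_wpM2r ?arm_ge0//.
apply: (ler_sum_inj (h := id)) => //.
- move=> [x y]; rewrite in_fset_set ?inE; last exact: finite_exits.
  move=> [/= xm [xH xn] [yH yn] ym xy] _; split.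
    rewrite in_fset_set ?inE; last exact: finite_half_exits.
    split => //; split => //; first exact: le_box (leq_addr _ _) _ xm.
    exact: box_adjacent xm xy.
  by apply: le_cprob => // z [zm [zH _]].
- by move=> xy; exact: cprob_ge0.
Qed.

(* If [X] is the number of exits reached by the cluster of 0, then
   [E X <= lam * P(X > 0) + E X^2 / lam], and the tree-graph inequality bounds
   [E X^2] by [F^2] times the susceptibility. *)
Lemma half_flux_truncation (lam F X : R) n : (L <= n)%N -> 0 < lam ->
  (forall w, box n w -> box_flux n w <= F) ->
  \sum_(x <- fset_set (H `&` box n)) ctau (H `&` box n) 0 x <= X ->
  half_flux n <= lam * half_arm (n - L) + lam^-1 * (F ^+ 2 * X).
Proof.
move=> Ln lam0 FF XX; set l := fset_set (exits (box n) (H `&` box (n + L))).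
have fD := @finite_half_box n.
have DD := @subset_refl _ (H `&` box n).
pose A (xy : V * V) (w : config (edges L : set (set V))) :=
  connected_in w (H `&` box n) [set 0] [set xy.1].
have := @pr_second_moment R d L p p01' _ _ l A lam fD
  (fun _ => connected_in_local DD) lam0.
move=> H1; apply: (le_trans H1) => {H1}.
have mem_l xy : xy \in (l : seq _) = `[< exits (box n) (H `&` box (n + L)) xy >].
  by rewrite in_fset_set; [apply/idP/asboolP; rewrite inE|exact: finite_half_exits].
apply: lerD.
  (* The inner end of an exit is outside [box (n - L)], so a reached exit yields a half-space arm of
     length [n - L]. *)
  rewrite ler_pM2l//; apply: le_pr => //; last 1 first.
  - move=> w [[x y]]; rewrite mem_l => /asboolP[/= xn _ _ yn xy].
    apply: connected_in_sub => //; first by rewrite subnK.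
    by move=> _ -> /=; exact: adjacent_box_out xy.
  - apply: (@local_measurable _ _ _ p p01' (H `&` box n)) => //.
    move=> w w' ww' [xy xyl H1]; exists xy => //.
    exact: (connected_in_local DD ww' H1).
  - exact: measurable_connected_in.
rewrite ler_pM2l ?invr_gt0//.
have F0 : 0 <= F.
  apply: le_trans (FF 0 (@box0 d n)); apply: sumr_ge0 => xy _; exact: cprob_ge0.
(* Summing the tree-graph bound over both exits first produces the square of the flux seen from the
   branching vertex [z]. *)
apply: (@le_trans _ _ (\sum_(z <- fset_set (H `&` box n))
    ctau (H `&` box n) 0 z * (\sum_(i <- l) ctau (H `&` box n) z i.1) ^+ 2)).
  apply: (@le_trans _ _ (\sum_(i <- l) \sum_(j <- l) \sum_(z <- fset_set (H `&` box n))
     ctau (H `&` box n) 0 z * ctau (H `&` box n) z i.1 * ctau (H `&` box n) z j.1)).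
    by apply: ler_sum => i _; apply: ler_sum => j _; exact: tree_graph.
  under eq_bigr do rewrite exchange_big.
  rewrite exchange_big /=; apply: ler_sum => z _.
  rewrite expr2 mulr_suml mulr_sumr; apply: ler_sum => i _.
  by rewrite !mulr_sumr; apply: ler_sum => j _; rewrite mulrA.
rewrite mulrC; apply: (@le_trans _ _ (\sum_(z <- fset_set (H `&` box n))
    ctau (H `&` box n) 0 z * F ^+ 2)); last first.
  by rewrite -mulr_suml ler_wpM2r// sqr_ge0.
rewrite [leLHS]big_seq [leRHS]big_seq; apply: ler_sum => z.
rewrite in_fset_set ?inE// => -[_ zn].
rewrite ler_wpM2l ?cprob_ge0// lerXn2r// ?nnegrE//.
  by apply: sumr_ge0 => i _; exact: cprob_ge0.
apply: le_trans (FF z zn); apply: (ler_sum_inj (h := id)) => //.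
- move=> [x y]; rewrite mem_l => /asboolP[/= xn [xH xL] [yH yL] yn xy] _; split.
    by rewrite in_fset_set ?inE//; exact: finite_box_exits.
  by apply: le_cprob => // v [].
- by move=> xy; exact: cprob_ge0.
Qed.

End estimates.

(** * Lower bound on the half-space flux *)

Section flux_lower_bound.
Context {R : realType} {d L : nat}.
Local Notation V := 'rV[int]_d.+1.
Implicit Types (x y z a b w : V) (S D A B : set V) (n m k : nat).
Variable p : R.
Hypothesis p01 : 0 < p <= 1.
Local Notation H := (@half_space d.+1).
Local Notation ctau := (@ctau R d L p).
Local Notation cprob := (@cprob R d L p).
Local Notation exits := (@exits d L).
Local Notation box_flux := (@box_flux R d L p).
Local Notation half_flux := (@half_flux R d L p).

Let p01' : 0 <= p <= 1. Proof. by case/andP: p01 => /ltW ->. Qed.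
Let p_gt0 : 0 < p. Proof. by case/andP: p01. Qed.
Let p_le1 : p <= 1. Proof. by case/andP: p01. Qed.

Lemma sum_le_susceptibility D : finite_set D ->
  ((\sum_(x <- fset_set D) ctau D 0 x)%:E <= susceptibility d.+1 L p)%E.
Proof.
move=> fD; apply: (sum_le_esum (h := id)) => // x _ _.
by split => //; exact: ctau_tau.
Qed.

Lemma phi_box_le n : (phi L p (@box d.+1 n) <= (p * box_flux n 0)%:E)%E.
Proof.
rewrite EFinM; apply: lee_wpmul2l; first by rewrite lee_fin ltW.
rewrite (_ : [set xy | _] = exits (box n) (box (n + L))); last first.
  apply/seteqP; split => -[x y] /= [].
    move=> xn yn xy; split => //=; first exact: le_box (leq_addr _ _) _ xn.
    exact: box_adjacent xn xy.
  by move=> xn _ _ yn xy.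
apply: esum_le_sum; first exact: finite_box_exits.
move=> xy _; rewrite measure_ge0 /= /tau /connection_probability.
by rewrite percolation_pr//; exact: measurable_connected_in.
Qed.

Definition top_flux n : R :=
  \sum_(xy <- fset_set (exits (box n) (box (n + L))) | n%:Z < xy.2 0 0)
    ctau (box n) 0 xy.1.

(** Seen from the centre of the box, all faces are equivalent under reflections and permutations of
    the coordinates. *)
Lemma box_flux_le_top n : box_flux n 0 <= (d.+1 * 2)%:R * top_flux n.
Proof.
apply: (box_flux_faces (n := n)).
- by move=> xy; exact: cprob_ge0.
- by move=> xy; rewrite in_fset_set ?inE; [case|exact: finite_box_exits].
move=> [c i] /=; pose g := flip c i (0 : V).
have gE z (k : 'I_d.+1) : (g z) 0 k = if c then - z 0 (tperm 0 i k) else z 0 (tperm 0 i k).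
  by rewrite flipE mxE; case: (c); rewrite ?sub0r ?subr0.
have g_box z : box n z -> box n (g z).
  by move=> zn k; rewrite gE; have := zn (tperm 0 i k); case: (c); lia.
have g_boxV m z : box m (g z) -> box m z.
  move=> zn k; have := zn (tperm 0 i k); rewrite gE tpermK; case: (c); lia.
have g_iso : forall x y, `|g x - g y| = `|x - y| by exact: flip_isometry.
rewrite /top_flux [leRHS]big_mkcond /=.
apply: (ler_sum_inj (h := fun xy : V * V => (g xy.1, g xy.2))).
- exact: fset_uniq.
- by move=> [x y] [x' y'] _ _ _ _ /= [/(isometry_inj g_iso) -> /(isometry_inj g_iso) ->].
- move=> [x y]; rewrite in_fset_set ?inE; last exact: finite_box_exits.
  move=> [/= xn xL yL yn xy] yi; split.
    rewrite in_fset_set ?inE; last exact: finite_box_exits.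
    have gxy : Defs.adjacent L (g x) (g y).
      move/adjacentP: xy => [nxy xyL]; apply/adjacentP; split.
        by move/(isometry_inj g_iso).
      by rewrite g_iso.
    split => //=; first exact: g_box.
    + by apply: le_box (leq_addr _ _) _ _; exact: g_box.
    + by apply: box_adjacent gxy; exact: g_box.
    + by move=> /g_boxV.
  have -> : n%:Z < (g y) 0 0 by move: yi; rewrite gE tpermL.
  apply: (cprob_isometry p01' (g := g)) => //; try exact: finite_box.
  + by move=> _ [z zn <-]; exact: g_box.
  + by move=> _ [_ -> <-]; exact: flip_id.
  + by move=> _ [_ -> <-].
- by move=> xy; case: ifP => _ //; exact: cprob_ge0.
Qed.

(* A path from 0 to the top is cut at its lowest point [z], and then where it
   leaves the ball of radius [n - L] about [z]: the middle piece stays in the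
   half-space with [z] on its boundary. *)
Lemma top_flux_le (b F : R) n : (0 < L <= n)%N -> 0 <= b ->
  (forall k, (phi L p (shifted_half_space k%:Z : set V) <= b%:E)%E) ->
  (forall w, box n w -> box_flux n w <= F) ->
  top_flux n <= n.+1%:R * (b / p) * (half_flux (n - L) * F).
Proof.
move=> /andP[L0 Ln] b0 phib boxF; have F0 : 0 <= F.
  apply: le_trans (boxF 0 (@box0 d n)); apply: sumr_ge0 => xy _; exact: cprob_ge0.
pose D z := box n `&` [set v : V | z 0 0 <= v 0 0].
have fD z : finite_set (D z) by apply: (finite_sub_box (n := n)) => v [].
pose Z := box n `&` [set z : V | z 0 0 <= (0 : V) 0 0].
have fZ : finite_set Z by apply: (finite_sub_box (n := n)) => v [].
set l := fset_set (exits (box n) (box (n + L))).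
have mem_l xy : xy \in (l : seq _) = `[< exits (box n) (box (n + L)) xy >].
  by rewrite in_fset_set; [apply/idP/asboolP; rewrite inE|exact: finite_box_exits].
apply: (@le_trans _ _ (\sum_(z <- fset_set Z) ctau (D z) 0 z * (half_flux (n - L) * F))).
  apply: (@le_trans _ _ (\sum_(xy <- l | n%:Z < xy.2 0 0) \sum_(z <- fset_set Z)
      ctau (D z) 0 z * ctau (D z) z xy.1)).
    apply: ler_sum => xy _.
    exact: (lowest_point_bound p01' (fun v : V => v 0 0) 0 xy.1 (finite_box n)).
  rewrite exchange_big /=; apply: ler_sum_seq => z; rewrite in_fset_set ?inE//.
  move=> [zn]; rewrite /= mxE => z0 _; rewrite -mulr_sumr ler_wpM2l ?cprob_ge0//.
  pose S := [set v : V | box (n - L) (v - z)].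
  apply: (@le_trans _ _ (\sum_(xy <- l | n%:Z < xy.2 0 0)
      \sum_(uv <- fset_set (exits S (D z)))
        ctau (S `&` D z) z uv.1 * p * ctau (D z) uv.2 xy.1)).
    apply: ler_sum_seq => -[x y]; rewrite mem_l => /asboolP[/= xn _ _ yn xy] /= yn0.
    apply: (simon_lieb p01' (S := S)) => //.
      by rewrite /S /= subrr; exact: box0.
    (* The outer end of the exit is higher than [n] and [z] has height at most 0, so the inner end
       is more than [n - L] above [z]. *)
    move=> _ -> /(_ 0); rewrite coordB.
    by have := adjacent_coord xy 0; lia.
  rewrite exchange_big /=.
  apply: (@le_trans _ _ (\sum_(uv <- fset_set (exits S (D z))) ctau (S `&` D z) z uv.1 * F)).
    apply: ler_sum_seq => -[u v]; rewrite in_fset_set ?inE//; last exact: finite_exits.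
    move=> [/= _ _ [vn _] _ _] _; rewrite -mulr_sumr -mulrA ler_wpM2l ?cprob_ge0//.
    rewrite -[leRHS]mul1r ler_pM ?(ltW p_gt0)//.
      by apply: sumr_ge0 => xy _; exact: cprob_ge0.
    apply: le_trans (boxF v vn); rewrite big_mkcond /=; apply: ler_sum => xy _.
    case: ifP => _; last exact: cprob_ge0.
    by apply: le_cprob => // t [].
  rewrite -mulr_suml ler_wpM2r//.
  apply: (ler_sum_inj (h := fun uv : V * V => (uv.1 - z, uv.2 - z))).
  - exact: fset_uniq.
  - by move=> [u v] [u' v'] _ _ _ _ /= [/addIr -> /addIr ->].
  - move=> [u v]; rewrite in_fset_set ?inE; last exact: finite_exits.
    move=> [/= uS [un uz] [vn vz] vS uv] _.
    have uv' : Defs.adjacent L (u - z) (v - z).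
      move/adjacentP: uv => [nuv uvL]; apply/adjacentP.
      by rewrite translation_isometry; split => // /addIr.
    have Hz (t : V) : z 0 0 <= t 0 0 -> H (t - z).
      by move=> zt; apply/half_spaceP; rewrite coordB subr_ge0.
    split.
      rewrite in_fset_set ?inE; last exact: finite_half_exits.
      split => //=.
      + by split; [exact: Hz|exact: le_box (leq_addr _ _) _ uS].
      + by split; [exact: Hz|exact: box_adjacent uS uv'].
    apply: (cprob_isometry p01' (g := fun t => t - z)) => //.
    + exact: translation_isometry.
    + by apply: (finite_sub_box (n := n)) => t [_ []].
    + exact: finite_half_box.
    + by move=> _ [t [tS [tn tz]] <-]; split => //; exact: Hz.
    + by move=> _ [_ -> <-]; rewrite /= subrr.
    + by move=> _ [_ -> <-].
  - by move=> uv; exact: cprob_ge0.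
rewrite -mulr_suml ler_wpM2r ?mulr_ge0 ?half_flux_ge0//.
(* Possible lowest points are sorted by height: those at height $-k$ lie on the bottom layer of the
   half-space of depth [k], and there are [n.+1] levels. *)
apply: (@le_trans _ _ (\sum_(k <- iota 0 n.+1)
    \sum_(z <- fset_set Z | z 0 0 == - k%:Z) ctau (D z) 0 z)).
  apply: ler_sum_cover; first by move=> z; exact: cprob_ge0.
  move=> z; rewrite in_fset_set ?inE// => -[zn z0'].
  have z0 : z 0 0 <= 0 by move: z0'; rewrite /= mxE.
  have zE : - (absz (z 0 0))%:Z = z 0 0 by rewrite lez0_abs// opprK.
  exists (absz (z 0 0)); last by rewrite zE.
  rewrite mem_iota add0n ltnS /=; have /andP[zn0 _] := zn 0.
  by rewrite -lez_nat lez0_abs// lerNl.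
apply: (@le_trans _ _ (\sum_(k <- iota 0 n.+1) b / p)); last first.
  by rewrite big_const_seq count_predT size_iota iter_addr_0 mulr_natl.
apply: ler_sum => k _; apply: (level_flux p01 (h := id) L0 (phib k)) => //.
  exact: fset_uniq.
move=> z; rewrite in_fset_set ?inE// => -[zn _] /eqP zk; split => //.
apply: ctau_tau => // v [_ /= zv]; apply/shifted_half_spaceP.
by rewrite -zk.
Qed.

End flux_lower_bound.

(** * The critical point lies strictly between 0 and 1 *)

Section critical_point_bounds.
Context {R : realType} {d L : nat} (L_gt0 : (0 < L)%N).
Local Notation V := 'rV[int]_d.+1.
Local Notation E := (edges L : set (set V)).
Local Notation conf := (config E).
Local Notation pc := (critical_point d.+1 R L).
Local Notation H := (@half_space d.+1).
Implicit Types (p : R) (n m k : nat).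

Lemma Ex_parameter1 (I : choiceType) (s : seq I) (F : (I -> bool) -> R) :
  Ex 1 s F = F (fun e => e \in s).
Proof.
elim: s F => [//|e s ih] F /=; rewrite !ih subrr mul0r addr0 mul1r.
by congr F; apply/funext => i; rewrite /upd inE; case: eqP.
Qed.

Definition line (i : 'I_d.+1) k : V := \row_j (if j == i then k%:Z else 0).

Lemma lineE i k j : line i k 0 j = if j == i then k%:Z else 0.
Proof. by rewrite mxE. Qed.

Lemma line0 i : line i 0 = 0.
Proof. by apply/rowP => j; rewrite !mxE; case: ifP. Qed.

Lemma line_adjacent i k : Defs.adjacent L (line i k) (line i k.+1).
Proof.
apply/adjacentP; split.
  move=> /(congr1 (fun z : V => z 0 i)); rewrite !lineE eqxx; lia.
by apply/norm_coordP => // j; rewrite coordB !lineE; case: ifP; lia.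
Qed.

Lemma ctau1_line (D : set V) i k : finite_set D -> (forall m, (m <= k)%N -> D (line i m)) ->
  ctau (L := L) (1 : R) D 0 (line i k) = 1.
Proof.
move=> fD Dl; rewrite /ctau /cprob.
have l01 : 0 <= (1 : R) <= 1 by rewrite ler01 lexx.
rewrite (pr_Ex l01 fD (connected_in_local (@subset_refl _ D))) Ex_parameter1 ind_true//.
elim: k Dl => [|k ih] Dl.
  by rewrite line0; apply: connected_in_refl; rewrite -(line0 i); exact: Dl.
apply: connected_in_step (ih _) _ _; [|exact: Dl|].
  by move=> m mk; apply: Dl; exact: leqW.
have := line_adjacent i k; rewrite /Defs.adjacent => /mem_set ekE.
exists (@exist _ (fun A => A \in (edges L : set (set V))) _ ekE) => //=.
by rewrite mem_eds//; apply/asboolP => _ /= [->|->]; apply: Dl.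
Qed.

Definition escape n : set conf := [set w : conf | connected_in w setT [set 0] (~` box n)].

Lemma measurable_escape n : measurable (escape n).
Proof. exact: measurable_connected_in. Qed.

Lemma infinite_clusterE :
  [set w : conf | infinite_set (Defs.cluster w 0)] = \bigcap_n escape n.
Proof.
apply/seteqP; split => [w inf n _|w esc /= fin].
  apply: contrapT => nesc; apply: inf; apply: (finite_sub_box (n := n)) => z cz.
  apply: contrapT => zn; apply: nesc; apply: connected_in_sub cz => //.
  by move=> _ ->.
have [N HN] : exists N, Defs.cluster w 0 `<=` box N.
  exists (\max_(x <- fset_set (Defs.cluster w 0)) \max_(i < d.+1) absz (x 0 i)%R)%N.
  move=> x cx i; rewrite -ler_norml -abszE lez_nat.
  apply: (@leq_trans (\max_(i < d.+1) absz (x 0 i)%R)%N).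
    exact: (@leq_bigmax _ (fun i : 'I_d.+1 => absz (x 0 i)%R)).
  apply: (@leq_bigmax_seq _ (fset_set (Defs.cluster w 0) : seq V) xpredT
    (fun x : V => \max_(i < d.+1) absz (x 0 i)%R)%N) => //.
  by rewrite in_fset_set ?inE.
have [_ [b [-> nb _ _ cb]]] := connected_in_end (esc N I).
by apply: nb; exact: HN.
Qed.

Lemma measurable_infinite_cluster :
  measurable [set w : conf | infinite_set (Defs.cluster w 0)].
Proof.
by rewrite infinite_clusterE; apply: bigcapT_measurable => n; exact: measurable_escape.
Qed.

Lemma percolates_at_1 :
  percolation d.+1 L (1 : R) [set w | infinite_set (Defs.cluster w 0)] = 1%E.
Proof.
set P := percolation _ _ _.
have esc1 n : P (escape n) = 1%E.
  apply/eqP; rewrite eq_le probability_le1 /=; last exact: measurable_escape.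
  have fb := @finite_box d n.+1.
  have <- : (ctau (L := L) (1 : R) (box n.+1) 0 (line 0 n.+1))%:E = 1%E.
    congr EFin; apply: ctau1_line => // m mn j; rewrite lineE.
    by case: ifP; lia.
  rewrite -percolation_pr; last exact: measurable_connected_in.
  apply: le_measure; rewrite ?inE.
  - exact: measurable_connected_in.
  - exact: measurable_escape.
  - move=> w; apply: connected_in_sub => // _ -> /(_ 0).
    by rewrite lineE eqxx; lia.
have mA := measurable_infinite_cluster.
have : P (~` [set w | infinite_set (Defs.cluster w 0)]) = 0%E.
  apply/negligibleP; first exact: measurableC.
  rewrite infinite_clusterE setC_bigcap; apply: negligible_bigcup => n.
  apply/negligibleP; first by apply: measurableC; exact: measurable_escape.
  have := probability_setC P (measurable_escape n).
  by rewrite [P (escape n)]esc1 subee.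
move=> PC; have := probability_setC P mA; rewrite [P (~` _)]PC => /eqP.
by rewrite eq_sym sube_eq ?add0e// => /eqP <-.
Qed.

(** The box of radius 0 is the origin alone, so its [phi] is at most the parameter times the number
    of exits; once this is at most one half, [arm_step] makes the arm decay exponentially. *)
Lemma does_not_percolate p : 0 <= p ->
  p * (#|` fset_set (@exits d L (box 0) (box (0 + L)))|).+1%:R <= 2^-1 ->
  percolation d.+1 L p [set w | infinite_set (Defs.cluster w 0)] = 0%E.
Proof.
set N := #|` _|%N => p0 pN.
(* [p] may be 0 while the arm estimates need a positive parameter; by monotonicity it is enough to
   work at this [q], which is at least [p]. *)
pose q : R := (2 * N.+1%:R)^-1.
have N0 : 0 < N.+1%:R :> R by rewrite ltr0n.
have pq : p <= q by rewrite /q invfM ler_pdivlMr.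
have q01 : 0 < q <= 1.
  rewrite invr_gt0 mulr_gt0//= invf_le1 ?mulr_gt0//.
  by rewrite (le_trans (_ : 1 <= 2))// ?ler1n// ler_peMr// ler1n.
have /andP[q0 q1] := q01.
have phiq : (phi L q (@box d.+1 0) <= (2^-1)%:E)%E.
  apply: le_trans (phi_box_le q01 0) _; rewrite lee_fin.
  apply: (@le_trans _ _ (q * N.+1%:R)).
    rewrite ler_pM2l//; apply: (@le_trans _ _ N%:R); last by rewrite ler_nat.
    rewrite /N -sum1_size natr_sum; apply: ler_sum => xy _; exact: cprob_le1.
  by rewrite /q invfM divfK ?gt_eqF.
have armq j : arm (L := L) (d := d) q (j * L) <= 2^-1 ^+ j.
  elim: j => [|j ih]; first by rewrite expr0; exact: cprob_le1.
  have := arm_step q01 phiq (_ : (0 + L <= j.+1 * L)%N).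
  rewrite add0n mulSn leq_addr => /(_ isT) /le_trans; apply.
  by rewrite addKn exprS ler_pM2l// invr_gt0.
apply/eqP; rewrite eq_le measure_ge0 andbT; apply/lee_addgt0Pr => e e0.
rewrite add0e.
have [j je] : exists j, 2^-1 ^+ j <= e.
  have e1 : 0 < e^-1 by rewrite invr_gt0.
  exists (Num.trunc e^-1).+1.
  rewrite exprVn -[leRHS]invrK lef_pV2 ?posrE ?exprn_gt0//.
  apply: (@le_trans _ _ (Num.trunc e^-1).+1%:R); first exact/ltW/truncnS_gt.
  by rewrite -natrX ler_nat ltnW// ltn_expl.
apply: (@le_trans _ _ (arm (L := L) (d := d) q (j * L))%:E); last first.
  by rewrite lee_fin (le_trans (armq j)).
apply: (@le_trans _ _ (cprob (L := L) p (@box d.+1 (j * L + L)) [set 0] (~` box (j * L)))%:E).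
  rewrite -percolation_pr; last exact: measurable_connected_in.
  apply: le_measure; rewrite ?inE.
  - exact: measurable_infinite_cluster.
  - exact: measurable_connected_in.
  - rewrite infinite_clusterE => w /(_ (j * L)%N I).
    have b0 : [set 0] `<=` @box d.+1 (j * L) by move=> _ ->; exact: box0.
    move=> /(connected_in_truncate b0 (fun _ => id)); apply: connected_in_sub => //.
    move=> z [_ [zn|[x xn xz]]]; last exact: box_adjacent xn xz.
    exact: le_box (leq_addr _ _) _ zn.
by rewrite lee_fin; apply: le_cprob_p => //; exact: finite_box.
Qed.

Lemma critical_point_gt0 : 0 < pc.
Proof.
pose N := #|` fset_set (@exits d L (box 0) (box (0 + L)))|%N.
have N0 : 0 < N.+1%:R :> R by rewrite ltr0n.
apply: (@lt_le_trans _ _ (2 * N.+1%:R)^-1); first by rewrite invr_gt0 mulr_gt0.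
apply: lb_le_inf.
  by exists 1; rewrite /= ler01 lexx percolates_at_1.
move=> p /= [/andP[p0 p1] pinf]; rewrite leNgt; apply/negP => pN.
move: pinf; rewrite does_not_percolate ?ltxx//.
by rewrite -ler_pdivlMr// -invfM ltW.
Qed.

Lemma critical_point_le1 : pc <= 1.
Proof.
apply: ge_inf; last by rewrite /= ler01 lexx percolates_at_1.
by exists 0 => p /= [/andP[]].
Qed.

(** At parameter 1 every vertex of a line inside the boundary hyperplane is reached with probability
    1 and contributes to [phi], which could then not be bounded. The line exists because the
    dimension is at least 2. *)
Lemma critical_point_lt1 (b : R) : (0 < d)%N ->
  (phi L pc (shifted_half_space 0%:Z : set V) <= b%:E)%E -> pc < 1.
Proof.
move=> d0 phib; rewrite lt_neqAle critical_point_le1 andbT.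
apply/eqP => pc1; move: phib; rewrite pc1 => phib.
pose i : 'I_d.+1 := inord 1.
have i0 : (0 == i) = false by apply/negP => /eqP/(congr1 val); rewrite /= inordK.
have p01 : 0 < (1 : R) <= 1 by rewrite ltr01 lexx.
pose N := (Num.trunc b).+1.
have line_inj : injective (line i).
  by move=> k m /(congr1 (fun z : V => z 0 i)); rewrite !lineE eqxx => -[].
have := @level_flux R d L 1 p01 0%N [seq line i k | k <- iota 0 N] xpredT id (fun=> 1) b
  L_gt0 phib.
rewrite map_inj_uniq ?iota_uniq// => /(_ isT (@inj_id _)) Hb.
have : (N%:R : R) <= b.
  rewrite -[leRHS]divr1; apply: le_trans (Hb _).
    by rewrite big_map big_const_seq count_predT size_iota iter_addr_0.
  move=> _ /mapP[k _ ->] _; rewrite lineE i0; split => //.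
  pose D : set V := [set line i m | m in `I_k.+1].
  have fD : finite_set D by apply: finite_image; exact: finite_II.
  apply: (@le_trans _ _ (ctau (L := L) (1 : R) D 0 (line i k))%:E).
    by rewrite ctau1_line// => m mk; exists m.
  apply: ctau_tau => _ [m _ <-]; apply/shifted_half_spaceP.
  by rewrite lineE i0.
by rewrite leNgt truncnS_gt.
Qed.

End critical_point_bounds.

(** * One-arm probabilities *)

Section power_law.
Context {R : realType}.

Lemma power_law_of_recursion (u : nat -> R) (e m0 : nat) (delta C : R) :
  (forall n, 0 <= u n <= 1) -> (forall n m, (n <= m)%N -> u m <= u n) ->
  0 <= delta -> 7 ^+ e * delta <= 2^-1 -> 0 <= C ->
  (forall m, (m0 <= m)%N -> u (4 * m)%N <= delta * u m + C / m%:R ^+ e) ->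
  exists2 A, 0 < A & forall n, (0 < n)%N -> u n <= A / n%:R ^+ e.
Proof.
move=> u01 udec delta0 delta7 C0 rec.
(* The first term of [A] covers [n < N]; the second gives $7^e C\le A/2$, which together with
   $7^e\delta A\le A/2$ closes the induction. *)
pose N := (4 * m0.+1)%N; pose A := N%:R ^+ e + 2 * (7 ^+ e * C).
have N0 : 0 < N%:R ^+ e :> R by rewrite exprn_gt0// ltr0n.
have S0 : 0 <= 7 ^+ e * C by rewrite mulr_ge0// exprn_ge0.
have A0 : 0 < A by rewrite ltr_pwDl// mulr_ge0.
exists A => // n; elim/ltn_ind: n => n ih n0.
have ne0 : 0 < n%:R ^+ e :> R by rewrite exprn_gt0// ltr0n.
rewrite ler_pdivlMr//; have [nN|Nn] := ltnP n N.
  have /andP[un0 un1] := u01 n.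
  apply: (@le_trans _ _ (1 * N%:R ^+ e)); last by rewrite mul1r lerDl mulr_ge0.
  rewrite ler_pM// ?(ltW ne0)// lerXn2r ?nnegrE ?ler0n// ler_nat.
  exact: ltnW.
pose m := (n %/ 4)%N.
(* From $n\le 4m+3$ and $m\ge 1$ one gets $n\le 7m$: this is the 7 of the hypothesis on [delta]. *)
have [mN m0' mn n4m n7m] :
    [/\ (m0 < m)%N, (0 < m)%N, (m < n)%N, (4 * m <= n)%N & (n <= 7 * m)%N].
  by rewrite /m; move: Nn n0; rewrite /N; clear; split; lia.
have me0 : 0 < m%:R ^+ e :> R by rewrite exprn_gt0// ltr0n.
have n7me : n%:R ^+ e <= 7 ^+ e * m%:R ^+ e :> R.
  rewrite -exprMn lerXn2r ?nnegrE ?mulr_ge0 ?ler0n//.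
  by rewrite -natrM ler_nat.
have um := ih m mn m0'.
have un : u n * m%:R ^+ e <= delta * A + C.
  apply: (@le_trans _ _ ((delta * (A / m%:R ^+ e) + C / m%:R ^+ e) * m%:R ^+ e)).
    rewrite ler_pM2r//; apply: le_trans (udec _ _ n4m) _.
    by apply: le_trans (rec m (ltnW mN)) _; rewrite lerD2r ler_wpM2l.
  by rewrite mulrDl mulrA !divfK ?gt_eqF.
have un0 : 0 <= u n by case/andP: (u01 n).
apply: (@le_trans _ _ (7 ^+ e * (u n * m%:R ^+ e))).
  by rewrite mulrCA ler_wpM2l.
apply: (@le_trans _ _ (7 ^+ e * (delta * A + C))).
  by rewrite ler_wpM2l// exprn_ge0.
rewrite mulrDr mulrA; apply: (@le_trans _ _ (2^-1 * A + 7 ^+ e * C)).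
  by rewrite lerD2r ler_wpM2r// ltW.
have : 2 * (7 ^+ e * C) <= A by rewrite lerDr ltW.
by move: (7 ^+ e * C) => S; lra.
Qed.

Lemma natr_ceil (x : R) : exists n : nat, x <= n%:R.
Proof. by exists (Num.trunc x).+1; exact/ltW/truncnS_gt. Qed.

Lemma expr4V_small (x : R) : 0 < x -> exists j : nat, (4^-1) ^+ j <= x.
Proof.
move=> x0; have [j xj] := natr_ceil x^-1; exists j.
rewrite exprVn -[leRHS]invrK lef_pV2 ?posrE ?exprn_gt0 ?invr_gt0//.
by rewrite (le_trans xj)// -natrX ler_nat ltnW// ltn_expl.
Qed.

End power_law.

Section arms.
Context {R : realType} {d L : nat}.
Local Notation V := 'rV[int]_d.+1.
Local Notation H := (@half_space d.+1).
Local Notation arm := (@arm R d L).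
Local Notation half_arm := (@half_arm R d L).

Lemma connected_in_half_boxE n :
  [set w | connected_in (L := L) w H [set 0] (~` @box d.+1 n)] =
  [set w | connected_in (L := L) w (H `&` box (n + L)) [set 0] (~` box n)].
Proof.
apply/seteqP; split => w; last by apply: connected_in_sub => // z [].
have b0 : [set 0] `<=` @box d.+1 n by move=> _ ->; exact: box0.
move=> /(connected_in_truncate b0 (fun _ => id)); apply: connected_in_sub => //.
move=> z [Hz [zn|[x xn xz]]]; split => //; last exact: box_adjacent xn xz.
exact: le_box (leq_addr _ _) _ zn.
Qed.

Lemma connection_probability_half_arm (p : R) n :
  connection_probability d.+1 L p half_space [set 0] (~` box n) = (half_arm p n)%:E.
Proof.
rewrite /connection_probability connected_in_half_boxE percolation_pr//.
exact: measurable_connected_in.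
Qed.

Lemma half_arm_antitone (p : R) n m : (n <= m)%N -> half_arm p m <= half_arm p n.
Proof.
move=> nm; rewrite -lee_fin -!connection_probability_half_arm.
apply: le_measure; rewrite ?inE; [exact: measurable_connected_in..|].
move=> w; apply: connected_in_sub => // z zm zn; apply: zm; exact: le_box zn.
Qed.

Lemma arm_antitone (p : R) n m : 0 < p <= 1 -> (n <= m)%N -> arm p m <= arm p n.
Proof.
move=> p01 nm; rewrite -[n in leRHS]subn0.
apply: (le_trans _ (translated_arm p01 (finite_box (m + L)) (@box0 d 0) (leq0n n))).
by apply: le_cprob => // z zm zn; apply: zm; exact: le_box zn.
Qed.

End arms.

(** * Half-space one-arm bounds at criticality *)

Section one_arm.
Context {R : realType} {d L : nat} (L_gt0 : (0 < L)%N) (d_gt0 : (0 < d)%N).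
Local Notation V := 'rV[int]_d.+1.
Local Notation H := (@half_space d.+1).
Local Notation pc := (critical_point d.+1 R L).
Local Notation arm := (@arm R d L).
Local Notation half_arm := (@half_arm R d L).
Local Notation half_flux := (@half_flux R d L).
Local Notation box_flux := (@box_flux R d L).
Variables (c1 C1 : R).
Hypotheses (c1_gt0 : 0 < c1) (C1_gt0 : 0 < C1).
Hypothesis chi_bound : forall p, 0 <= p < pc ->
  ((c1 * (pc - p)^-1)%:E <= susceptibility d.+1 L p <= (C1 * (pc - p)^-1)%:E)%E.
Hypothesis length_bound : forall p, 0 <= p < pc ->
  ((c1 * (Num.sqrt (pc - p))^-1)%:E <= correlation_length d.+1 L p
     <= (C1 * (Num.sqrt (pc - p))^-1)%:E)%E.
Hypothesis flux_bound : forall (p : R) (n : nat), 0 <= p <= pc ->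
  (phi L p (shifted_half_space n%:Z : set V)
     <= (C1 * expR (- c1 * Num.sqrt (pc - p) * n%:R))%:E)%E.

Let pc_gt0 : 0 < pc. Proof. exact: critical_point_gt0. Qed.

Let pc_lt1 : pc < 1.
Proof.
have pc0 : 0 <= pc <= pc by rewrite ltW/=.
exact: (critical_point_lt1 L_gt0 d_gt0 (flux_bound 0 pc0)).
Qed.

Let pc01 : 0 < pc <= 1. Proof. by rewrite pc_gt0 ltW. Qed.

(* Parameters below criticality are written [pc - s ^+ 2], so that the
   correlation length is of order [s^-1]. *)
Let near s := 0 < s /\ s <= Num.min 1 (pc / 2).

Let nearP s : near s -> [/\ 0 < s, s <= 1 & s ^+ 2 <= pc / 2].
Proof.
move=> [s0]; rewrite le_min => /andP[s1 spc]; split => //.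
by rewrite (le_trans _ spc)// expr2 ger_pMr.
Qed.

Let p_ s := pc - s ^+ 2.

Let p_bounds s : near s -> [/\ 0 < p_ s, pc / 2 <= p_ s, p_ s < pc & p_ s < 1].
Proof.
move=> /nearP[s0 _ s2]; rewrite /p_; have s20 : 0 < s ^+ 2 by rewrite exprn_gt0.
split; move: pc_gt0 pc_lt1 s2 s20; move: (s ^+ 2) => t; lra.
Qed.

Let p01_ s : near s -> 0 < p_ s <= 1.
Proof. by move=> /p_bounds[-> _ _ /ltW ->]. Qed.

Let p0pc_ s : near s -> 0 <= p_ s < pc.
Proof. by move=> /p_bounds[/ltW -> _ ->]. Qed.

Let pc_sub s : pc - p_ s = s ^+ 2. Proof. by rewrite /p_ subKr. Qed.

Let sqrt_sub s : near s -> Num.sqrt (pc - p_ s) = s.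
Proof. by move=> /nearP[s0 _ _]; rewrite pc_sub sqrtr_sqr gtr0_norm. Qed.

Let phi_half s k : near s ->
  (phi L (p_ s) (shifted_half_space k%:Z : set V) <=
   (C1 * expR (- (c1 * s) * k%:R))%:E)%E.
Proof.
move=> ns; have /andP[p0 ppc] := p0pc_ ns.
have := @flux_bound (p_ s) k; rewrite p0 ltW// => /(_ isT).
by rewrite sqrt_sub// mulNr.
Qed.

Let phi_half_C1 s k : near s ->
  (phi L (p_ s) (shifted_half_space k%:Z : set V) <= C1%:E)%E.
Proof.
move=> ns; apply: le_trans (phi_half k ns) _; rewrite lee_fin ger_pMr//.
have [s0 _ _] := nearP ns.
by rewrite -[leRHS]expR0 ler_expR mulNr oppr_le0 !mulr_ge0// ltW.
Qed.

(** A bound on box fluxes uniform in [s], since [near] keeps [p_ s] at least [pc / 2]. *)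
Let F := (d.+1 * 2)%:R * (C1 / (pc / 2)).

Let F_gt0 : 0 < F.
Proof. by rewrite mulr_gt0// ?ltr0n// !divr_gt0. Qed.

Let box_flux_F s n w : near s -> box n w -> box_flux (p_ s) n w <= F.
Proof.
move=> ns wn; have [p0 p2 _ _] := p_bounds ns.
apply: le_trans (le_box_flux (p01_ ns) wn (fun k => phi_half_C1 k ns)) _.
rewrite ler_pM2l ?ltr0n// ler_pM2l// lef_pV2 ?posrE//.
by rewrite divr_gt0.
Qed.

(** Chosen so that the half-space susceptibility is at most [X / s], using $1+1/(c_1 s)\le
    (1+1/c_1)/s$ for $s\le 1$. *)
Let X := C1 / (pc / 2) * (1 + c1^-1).

Let X_gt0 : 0 < X.
Proof. by rewrite mulr_gt0 ?divr_gt0// addr_gt0// invr_gt0. Qed.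

Let half_susceptibility_X s (D : set V) : near s -> finite_set D -> D `<=` H ->
  \sum_(x <- fset_set D) ctau (L := L) (p_ s) D 0 x <= X / s.
Proof.
move=> ns fD DH; have [p0 p2 _ _] := p_bounds ns; have [s0 s1 _] := nearP ns.
have cs0 : 0 < c1 * s by rewrite mulr_gt0.
apply: le_trans (half_susceptibility (p01_ ns) L_gt0 (ltW C1_gt0) cs0
  (fun k => phi_half k ns) fD DH) _.
rewrite /X -[leRHS]mulrA; apply: ler_pM.
- by rewrite divr_ge0// ltW.
- by rewrite addr_ge0// invr_ge0 ltW.
- by rewrite ler_pM2l// lef_pV2 ?posrE// divr_gt0.
by rewrite mulrDl mul1r invfM lerD// invf_ge1.
Qed.

Let M := (#|` fset_set (@box d.+1 L)|)%:R / (pc * (1 - pc)) : R.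

Let M_ge0 : 0 <= M.
Proof. by rewrite divr_ge0 ?ler0n// mulr_ge0 ?subr_ge0 ?ltW. Qed.

Let M2_ge0 x : 0 <= x -> 0 <= 2 * M * x.
Proof. by move=> x0; apply: mulr_ge0 => //; apply: mulr_ge0. Qed.

Let entropic_s s (D : set V) n (Y : R) : near s -> finite_set D -> D 0 ->
  \sum_(x <- fset_set D) ctau (L := L) (p_ s) D 0 x <= Y ->
  cprob (L := L) pc D [set 0] (~` box n) <=
  2 * cprob (L := L) (p_ s) D [set 0] (~` box n) + 2 * M * s ^+ 4 * Y.
Proof.
move=> ns fD D0 YY; have [p0 _ _ p1] := p_bounds ns.
have q01 : 0 < p_ s < 1 by rewrite p0 p1.
have pc01' : 0 < pc < 1 by rewrite pc_gt0 pc_lt1.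
have := entropic_cprob (L := L) (~` box n) fD D0 q01 pc01'.
rewrite pc_sub -exprM; set P := cprob pc _ _ _; set Q := cprob (p_ s) _ _ _.
have e2 : 2^-1 <= 1 - expR (-1) :> R.
  have : expR (-1) <= 2^-1 :> R.
    rewrite expRN lef_pV2 ?posrE ?expR_gt0//.
    by have := @expR_ge1Dx R 1.
  lra.
have P0 : 0 <= P by exact: cprob_ge0.
set N := #|` _|%N; set S := \sum_(x <- _) _.
move=> ent; have H1 : P <= 2 * ((1 - expR (-1)) * P).
  by rewrite mulrA ler_peMl//; lra.
have H2 : s ^+ 4 / (pc * (1 - pc)) * (N%:R * S) <= M * s ^+ 4 * Y.
  rewrite (_ : _ * (N%:R * S) = M * s ^+ 4 * S); last by rewrite /M -/N; ring.
  by rewrite ler_wpM2l// mulr_ge0// exprn_even_ge0.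
by apply: le_trans H1 _; move: ent H2; rewrite -!mulrA; set a := _ * P; lra.
Qed.

Let arm_s s n : near s -> arm pc n <= 2 * arm (p_ s) n + 2 * M * C1 * s ^+ 2.
Proof.
move=> ns; have [s0 _ _] := nearP ns.
have Y : \sum_(x <- fset_set (@box d.+1 (n + L)))
    ctau (L := L) (p_ s) (box (n + L)) 0 x <= C1 / s ^+ 2.
  rewrite -lee_fin; apply: le_trans (sum_le_susceptibility (p_ s) (finite_box (n + L))) _.
  by have /andP[_] := chi_bound (p0pc_ ns); rewrite pc_sub.
apply: le_trans (entropic_s n ns (finite_box _) (@box0 d _) Y) _.
by rewrite lerD2l le_eqVlt; apply/orP; left; apply/eqP; field; rewrite gt_eqF.
Qed.

Let half_arm_s s n : near s ->
  half_arm pc n <= 2 * half_arm (p_ s) n + 2 * M * X * s ^+ 3.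
Proof.
move=> ns; have [s0 _ _] := nearP ns.
have H0 : (H `&` @box d.+1 (n + L)) 0.
  by split; [apply/half_spaceP; rewrite mxE|exact: box0].
have HD : H `&` @box d.+1 (n + L) `<=` H by move=> z [].
apply: le_trans (entropic_s n ns (finite_half_box _) H0
  (half_susceptibility_X ns (finite_half_box _) HD)) _.
by rewrite lerD2l le_eqVlt; apply/orP; left; apply/eqP; field; rewrite gt_eqF.
Qed.

Let expR1_sqr : 4 <= expR 1 ^+ 2 :> R.
Proof.
have : 2 <= expR 1 :> R by have := @expR_ge1Dx R 1.
rewrite expr2; nra.
Qed.

Let length_le s : near s -> exists k : nat, k%:R <= 2 * C1 / s /\
  (phi L (p_ s) (@box d.+1 k) <= (4^-1)%:E)%E.
Proof.
move=> ns; have [s0 _ _] := nearP ns.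
have /andP[_] := length_bound (p0pc_ ns); rewrite sqrt_sub// => le1.
(* The factor 2 makes the inequality strict, so that a scale [k] can be extracted from the
   infimum. *)
have : (correlation_length d.+1 L (p_ s) < (2 * C1 / s)%:E)%E.
  apply: le_lt_trans le1 _; rewrite lte_fin ltr_pM2r ?invr_gt0//.
  by rewrite ltr_pMl// ltr1n.
move=> /ereal_inf_lt[_ [k [_ phik] <-]]; rewrite lte_fin => /ltW kk.
exists k; split => //; apply: le_trans phik _.
by rewrite lee_fin lef_pV2 ?posrE ?exprn_gt0 ?expR_gt0.
Qed.

Let length_ge s k : near s -> (0 < k)%N -> k%:R < c1 / s ->
  ((expR 1 ^+ 2)^-1%:E < phi L (p_ s) (@box d.+1 k))%E.
Proof.
move=> ns k0 kc; rewrite ltNge; apply/negP => phik.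
have /andP[le1 _] := length_bound (p0pc_ ns); move: le1; rewrite sqrt_sub//.
apply/negP; rewrite -ltNge; apply: le_lt_trans (_ : (_ <= k%:R%:E)%E) _.
  by apply: ereal_inf_lbound; exists k.
by rewrite lte_fin.
Qed.

Let arm_iter s k j n : near s -> (phi L (p_ s) (@box d.+1 k) <= (4^-1)%:E)%E ->
  (j * (k + L) <= n)%N -> arm (p_ s) n <= 4^-1 ^+ j * arm (p_ s) (n - j * (k + L)).
Proof.
move=> ns phik; elim: j n => [|j ih] n jn; first by rewrite mul1r subn0.
have jn' : (k + L <= n)%N by apply: leq_trans jn; rewrite mulSn leq_addr.
apply: le_trans (arm_step (p01_ ns) phik jn') _.
have -> : (n - j.+1 * (k + L) = n - (k + L) - j * (k + L))%N by rewrite mulSn subnDA.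
rewrite exprS -mulrA ler_pM2l ?invr_gt0//.
by apply: ih; rewrite leq_subRL// -mulSn.
Qed.

Let arm_le_pc s n : near s -> arm (p_ s) n <= arm pc n.
Proof.
move=> ns; have [p0 _ ppc _] := p_bounds ns.
by apply: le_cprob_p; [exact: ltW..|exact: finite_box].
Qed.

Let half_arm_le_pc s n : near s -> half_arm (p_ s) n <= half_arm pc n.
Proof.
move=> ns; have [p0 _ ppc _] := p_bounds ns.
by apply: le_cprob_p; [exact: ltW..|exact: finite_half_box].
Qed.

(* At parameter [pc - (K / m) ^+ 2] the correlation length is a small multiple
   of [m], hence the decay by an arbitrary factor over the length [m]. *)
Let arm_decay j : exists2 K : R, 0 < K & exists m0 : nat, forall m, (m0 <= m)%N ->
  [/\ (0 < m)%N, near (K / m%:R) & forall n, (m <= n)%N ->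
    arm (p_ (K / m%:R)) n <= 4^-1 ^+ j * arm pc (n - m)].
Proof.
(* At $s=K/m$ a good scale satisfies $k\le 2C_1 m/K$, so [j] such scales cover at most half of [m];
   the other half absorbs [j * L]. Using [j.+1] keeps [K] positive when [j] is 0. *)
pose K := 4 * C1 * j.+1%:R; have K0 : 0 < K by rewrite !mulr_gt0// ltr0n.
have mu0 : 0 < Num.min 1 (pc / 2) :> R by rewrite lt_min ltr01 divr_gt0.
have [N HN] := natr_ceil (K / Num.min 1 (pc / 2)).
exists K => //; exists (N + 2 * (j * L)).+1 => m mN.
have m0 : (0 < m)%N by apply: leq_ltn_trans mN.
have m0' : 0 < m%:R :> R by rewrite ltr0n.
have ns : near (K / m%:R).
  split; first by rewrite divr_gt0.
  rewrite ler_pdivrMr// mulrC -ler_pdivrMr// (le_trans HN)// ler_nat.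
  by apply: leq_trans (ltnW mN); rewrite leq_addr.
split => // n mn; have [k [kK phik]] := length_le ns.
have jkm : (j * (k + L) <= m)%N.
  have : j%:R * k%:R <= m%:R / 2 :> R.
    apply: (@le_trans _ _ (j%:R * (2 * C1 / (K / m%:R)))); first by rewrite ler_wpM2l.
    have -> : j%:R * (2 * C1 / (K / m%:R)) = (j%:R / j.+1%:R) * (m%:R / 2).
      rewrite /K; have : j.+1%:R != 0 :> R by rewrite pnatr_eq0.
      by move: (j.+1%:R : R) => J J0; field; rewrite J0 !gt_eqF.
    by rewrite ler_piMl ?divr_ge0// ler_pdivrMr ?ltr0n// mul1r ler_nat.
  rewrite ler_pdivlMr// -!natrM ler_nat => H1.
  by rewrite mulnDr; move: mN H1; move: (j * k)%N (j * L)%N => a b; clear; lia.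
apply: le_trans (arm_iter ns phik (leq_trans jkm mn)) _.
rewrite ler_wpM2l ?exprn_ge0 ?invr_ge0//.
apply: le_trans (arm_le_pc _ ns) _; apply: arm_antitone => //.
exact: leq_sub2l.
Qed.

Let arm_power_law : exists2 A : R, 0 < A &
  forall n, (0 < n)%N -> arm pc n <= A / n%:R ^+ 2.
Proof.
(* The recursion requires $7^2\cdot 2\cdot 4^{-j}\le 1/2$, that is $4^j\ge 196$, and 4 is the least
   such [j]. *)
have [K K0 [m0 HK]] := arm_decay 4.
apply: (@power_law_of_recursion _ (arm pc) 2 m0 (2 * 4^-1 ^+ 4) (2 * M * C1 * K ^+ 2)).
- by move=> n; rewrite arm_ge0/=; exact: cprob_le1.
- by move=> n m; exact: arm_antitone.
- by rewrite mulr_ge0// exprn_ge0// invr_ge0.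
- by lra.
- by apply: mulr_ge0 (M2_ge0 (ltW C1_gt0)) _; exact: sqr_ge0.
- move=> m mm; have [m0' ns decay] := HK m mm.
  have m0r : 0 < m%:R :> R by rewrite ltr0n.
  apply: le_trans (arm_s (4 * m) ns) _; apply: lerD; last first.
    by rewrite expr_div_n mulrA.
  rewrite -mulrA ler_pM2l//; apply: le_trans (decay (4 * m)%N _) _; first exact: leq_pmull.
  rewrite ler_wpM2l ?exprn_ge0 ?invr_ge0//; apply: arm_antitone => //.
  by clear; lia.
Qed.

Let half_arm_upper : exists2 A : R, 0 < A &
  forall n, (0 < n)%N -> half_arm pc n <= A / n%:R ^+ 3.
Proof.
have [A A0 HA] := arm_power_law.
(* The contraction factor [delta] contains [A], so [j] can be fixed only now. *)
have [j Hj] : exists j : nat, (4^-1) ^+ j <= (7 ^+ 3 * (2 * (2 * 4 * A)))^-1 :> R.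
  by apply: expr4V_small; rewrite invr_gt0 !mulr_gt0// exprn_gt0.
have [K K0 [m0 HK]] := arm_decay j.
pose delta := 2 * (4^-1 ^+ j * (4 * A)).
pose C := delta * (F ^+ 2 * X / K) + 2 * M * X * K ^+ 3.
have d0 : 0 <= delta by rewrite !mulr_ge0 ?exprn_ge0 ?invr_ge0 ?(ltW A0).
apply: (@power_law_of_recursion _ (half_arm pc) 3 (m0 + 2 * L) delta C) => //.
- by move=> n; rewrite half_arm_ge0/=; exact: cprob_le1.
- by move=> n m; exact: half_arm_antitone.
- rewrite (_ : _ * delta = 4^-1 ^+ j * (7 ^+ 3 * (2 * (2 * 4 * A))) / 2).
    rewrite -[leRHS]mul1r ler_pM2r// -ler_pdivlMr ?mul1r//.
    by rewrite !mulr_gt0// exprn_gt0.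
  by rewrite /delta; field.
- apply: addr_ge0; last first.
    by apply: mulr_ge0 (M2_ge0 (ltW X_gt0)) _; apply: exprn_ge0; exact: ltW.
  apply: mulr_ge0 => //; apply: divr_ge0; last exact: ltW.
  by apply: mulr_ge0; [exact: sqr_ge0|exact: ltW].
move=> m mm; have [|m0' ns decay] := HK m; first by move: mm; clear; lia.
have m0r : 0 < m%:R :> R by rewrite ltr0n.
pose s := K / m%:R.
(* The cutoff [m ^+ 2] is the inverse order of the full-space arm that will multiply it; the
   second-moment term is then of order $1/m$ and becomes $m^{-3}$ in the product. *)
have flux : half_flux (p_ s) (2 * m) <=
    m%:R ^+ 2 * half_arm pc m + (m%:R ^+ 2)^-1 * (F ^+ 2 * (X / s)).
  have HD : H `&` @box d.+1 (2 * m) `<=` H by move=> z [].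
  apply: le_trans (half_flux_truncation (p01_ ns) (n := (2 * m)%N)
    (lam := m%:R ^+ 2) _ _ (fun w => box_flux_F ns)
    (half_susceptibility_X ns (finite_half_box _) HD)) _.
  - by move: mm; clear; lia.
  - by rewrite exprn_gt0.
  rewrite lerD2r ler_pM2l ?exprn_gt0//; apply: le_trans (half_arm_le_pc _ ns) _.
  by apply: half_arm_antitone; move: mm; clear; lia.
(* Of the available length $2m-L$, a stretch [m] pays for the factor [4^-1 ^+ j]; the remaining
   $m-L$ is at least $m/2$, whence the 4 in front of [A]. *)
have armm : arm (p_ s) (4 * m - (2 * m + L)) <= 4^-1 ^+ j * (4 * A) / m%:R ^+ 2.
  apply: le_trans (decay _ _) _; first by move: mm; clear; lia.
  rewrite -mulrA ler_wpM2l ?exprn_ge0 ?invr_ge0//.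
  have [r0 mr] : (0 < 4 * m - (2 * m + L) - m)%N /\
      (m <= 2 * (4 * m - (2 * m + L) - m))%N by move: mm m0'; clear; split; lia.
  apply: le_trans (HA _ r0) _; move: r0 mr; set r := (_ - m)%N => r0 mr.
  have r0r : 0 < r%:R ^+ 2 :> R by rewrite exprn_gt0// ltr0n.
  have mr2 : m%:R ^+ 2 <= 4 * r%:R ^+ 2 :> R.
    rewrite (_ : 4 * _ = (2 * r%:R) ^+ 2); last by rewrite exprMn; congr (_ * _); ring.
    by rewrite lerXn2r ?nnegrE ?mulr_ge0 ?ler0n// -natrM ler_nat.
  rewrite ler_pdivlMr ?exprn_gt0// mulrAC ler_pdivrMr//.
  apply: le_trans (ler_wpM2l (ltW A0) mr2) _.
  by rewrite mulrCA mulrA.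
have step : half_arm (p_ s) (4 * m) <=
    (m%:R ^+ 2 * half_arm pc m + (m%:R ^+ 2)^-1 * (F ^+ 2 * (X / s))) *
    (4^-1 ^+ j * (4 * A) / m%:R ^+ 2).
  apply: le_trans (half_arm_step (p01_ ns) (n := (4 * m)%N) (m := (2 * m)%N) _) _.
    by move: mm; clear; lia.
  by rewrite ler_pM ?half_flux_ge0 ?arm_ge0.
apply: le_trans (half_arm_s (4 * m) ns) _; rewrite -/s.
have -> : delta * half_arm pc m + C / m%:R ^+ 3 =
  2 * ((m%:R ^+ 2 * half_arm pc m + (m%:R ^+ 2)^-1 * (F ^+ 2 * (X / s))) *
    (4^-1 ^+ j * (4 * A) / m%:R ^+ 2)) + 2 * M * X * s ^+ 3.
  rewrite /C /delta /s; move: (4^-1 ^+ j) (half_arm pc m) => y u.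
  by field; rewrite !gt_eqF.
by rewrite lerD2r ler_pM2l.
Qed.

Let half_arm_lower : exists2 c : R, 0 < c &
  forall n, (0 < n)%N -> c / n%:R ^+ 3 <= half_arm pc n.
Proof.
have mu0 : 0 < Num.min 1 (pc / 2) :> R by rewrite lt_min ltr01 divr_gt0.
(* At $s=\kappa/n$ the lower bound $c_1/s$ on the correlation length equals $2n$, so the scale [n]
   lies strictly below it. *)
pose kappa := c1 / 2; have kappa0 : 0 < kappa by rewrite divr_gt0.
have [N HN] := natr_ceil (kappa / Num.min 1 (pc / 2)).
pose G := F * F.
have G0 : 0 < G by apply: mulr_gt0.
pose eta : R := (expR 1 ^+ 2)^-1.
have eta0 : 0 < eta by rewrite invr_gt0 exprn_gt0// expR_gt0.
pose a := eta / G / 2; have a0 : 0 < a by rewrite !divr_gt0.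
pose b := F ^+ 2 * X / kappa; have b0 : 0 < b by rewrite divr_gt0// mulr_gt0// exprn_gt0.
pose q := (1 + 2 * L + N)%N.
have ab0 : 0 < a ^+ 2 / (4 * b).
  by apply: divr_gt0; [exact: exprn_gt0|exact: mulr_gt0].
exists (a ^+ 2 / (4 * b) / q%:R ^+ 3).
  by apply: divr_gt0 => //; rewrite exprn_gt0// ltr0n.
(* The two shifts by [L], one in the flux bound and one in the truncation, are paid by [2 * L]; the
   term [N] brings [s] into the range [near]. *)
move=> k k0; pose n := (k + 2 * L + N)%N.
have n0 : (0 < n)%N by rewrite /n -addnA ltn_addr.
have n0r : 0 < n%:R :> R by rewrite ltr0n.
have nq : (n <= q * k)%N by rewrite /n /q; move: k0; clear; nia.
pose s := kappa / n%:R.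
have ns : near s.
  split; first by rewrite divr_gt0.
  rewrite ler_pdivrMr// mulrC -ler_pdivrMr// (le_trans HN)// ler_nat.
  exact: leq_addl.
have s0 : 0 < s by have [] := nearP ns.
have [p0 p2 _ p1] := p_bounds ns.
have phin : ((expR 1 ^+ 2)^-1%:E < phi L (p_ s) (@box d.+1 n))%E.
  apply: length_ge => //; rewrite /s /kappa (_ : _ / _ = 2 * n%:R).
    by rewrite ltr_pMl// ltr1n.
  by field; rewrite !gt_eqF.
have flux : a / n%:R <= half_flux (p_ s) (n - L).
  have := lt_le_trans phin (phi_box_le (p01_ ns) n); rewrite lte_fin => /ltW etale.
  have Ln : (0 < L <= n)%N by rewrite L_gt0 /n; clear; lia.
  have top := top_flux_le (p01_ ns) Ln (ltW C1_gt0) (fun k => phi_half_C1 k ns)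
    (fun w => box_flux_F ns).
  have boxtop := box_flux_le_top (d := d) (L := L) (p01_ ns) n.
  have hf0 := half_flux_ge0 (L := L) (d := d) (p_ s) (n - L).
  have bf0 : 0 <= box_flux (p_ s) n 0 by apply: sumr_ge0 => xy _; exact: cprob_ge0.
  have : eta <= (2 * n%:R) * G * half_flux (p_ s) (n - L).
    apply: le_trans etale _; apply: (@le_trans _ _ (box_flux (p_ s) n 0)).
      by rewrite ler_piMl// ltW.
    apply: le_trans boxtop _.
    have -> : 2 * n%:R * G * half_flux (p_ s) (n - L) = (d.+1 * 2)%:R *
        (2 * n%:R * (C1 / (pc / 2)) * (half_flux (p_ s) (n - L) * F)).
      by rewrite /G /F; move: (C1 / (pc / 2)) => t; ring.
    rewrite ler_pM2l ?ltr0n//; apply: le_trans top _.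
    have hF : 0 <= half_flux (p_ s) (n - L) * F by apply: mulr_ge0 => //; exact: ltW.
    apply: ler_wpM2r => //.
    apply: ler_pM => //; first by rewrite divr_ge0// ltW.
      by rewrite -natrM ler_nat; move: n0; clear; lia.
    by rewrite ler_pM2l// lef_pV2 ?posrE// divr_gt0.
  rewrite /a => H1; rewrite ler_pdivrMr//.
  by rewrite !ler_pdivrMr// (le_trans H1)// le_eqVlt; apply/orP; left; apply/eqP; ring.
have HD : H `&` @box d.+1 (n - L) `<=` H by move=> z [].
(* With this cutoff the second-moment term is exactly half of the lower bound [a / n] on the flux,
   so the arm term carries the other half. *)
pose lam := 2 * b * n%:R ^+ 2 / a.
have lam0 : 0 < lam.
  by apply: divr_gt0 => //; apply: mulr_gt0; [exact: mulr_gt0|exact: exprn_gt0].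
have := half_flux_truncation (p01_ ns) (n := (n - L)%N) (lam := lam) _ lam0
  (fun w => box_flux_F ns) (half_susceptibility_X ns (finite_half_box _) HD).
have -> : (L <= n - L)%N by rewrite /n; clear; lia.
move=> /(_ isT)/(le_trans flux) trunc.
have armn : half_arm (p_ s) (n - L - L) <= half_arm pc k.
  apply: le_trans (half_arm_le_pc _ ns) _; apply: half_arm_antitone.
  by rewrite /n; clear; lia.
have E : lam^-1 * (F ^+ 2 * (X / s)) = a / n%:R / 2.
  by rewrite /lam /b /s; field; rewrite !gt_eqF.
have main : a / n%:R / 2 <= lam * half_arm pc k.
  have : lam * half_arm (p_ s) (n - L - L) <= lam * half_arm pc k by rewrite ler_pM2l.
  by move: trunc; rewrite E; move: (a / n%:R) (lam * _) (lam * _) => x y z; lra.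
apply: (@le_trans _ _ (a / n%:R / 2 / lam)); last by rewrite ler_pdivrMr// [leRHS]mulrC.
have -> : a / n%:R / 2 / lam = a ^+ 2 / (4 * b) / n%:R ^+ 3.
  by rewrite /lam; field; rewrite !gt_eqF.
rewrite -[leLHS]mulrA -invfM ler_pM2l//.
have k0r : 0 < k%:R :> R by rewrite ltr0n.
have q0r : 0 < q%:R :> R by rewrite ltr0n.
rewrite lef_pV2 ?posrE ?mulr_gt0 ?exprn_gt0// -exprMn lerXn2r ?nnegrE ?mulr_ge0//.
by rewrite -natrM ler_nat.
Qed.

Lemma half_space_one_arm : exists c C : R, [/\ 0 < c, 0 < C &
  forall n : nat, (1 <= n)%N ->
    ((c / n%:R ^+ 3)%:E <= connection_probability d.+1 L pc
        half_space [set 0%R] (~` box n) <= (C / n%:R ^+ 3)%:E)%E].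
Proof.
have [c c0 Hc] := half_arm_lower; have [C C0 HC] := half_arm_upper.
exists c, C; split => // n n1.
by rewrite connection_probability_half_arm !lee_fin Hc// HC.
Qed.

End one_arm.

Theorem theorem1p2 (R : realType) (d L0 L : nat) (d_gt6 : (6 < d)%N)
  (L0_ge1 : (1 <= L0)%N)
  (L0_estimates : forall L' : nat, (L0 <= L')%N ->
     near_critical_estimates d R L')
  (L_ge_L0 : (L0 <= L)%N) :
  exists c C : R, [/\ 0 < c, 0 < C &
    forall n : nat, (1 <= n)%N ->
      ((c / n%:R ^+ 3)%:E
         <= connection_probability d L (critical_point d R L)
              half_space [set 0%R] (~` box n)
         <= (C / n%:R ^+ 3)%:E)%E].
Proof.
case: d d_gt6 L0_estimates => [//|d] d_gt6 L0_estimates.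
have [c1 [C1 [c10 C10 chi len flux]]] := L0_estimates L L_ge_L0.
apply: (half_space_one_arm _ _ c10 C10 chi len flux); first exact: leq_trans L_ge_L0.
by rewrite -ltnS (leq_trans _ d_gt6).
Qed.
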